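(* Let $\mathcal{P}=\sum_{j=0}^n\mathcal{P}_j(\epsilon)\mathsf{Y}^j\in\mathcal{C}[\mathsf{Y}]$ with $\mathcal{P}_n=1$. The following assertions are equivalent: (1) There exist $\mathcal{Y}_1,\ldots,\mathcal{Y}_n\in\mathcal{C}$ such that $\mathcal{Y}_1(\epsilon),\ldots,\mathcal{Y}_n(\epsilon)$ are the roots of $\mathcal{P}(\epsilon,y)=0$ counted with multiplicities, and $\mathcal{Y}_1,\ldots,\mathcal{Y}_n$ have first order asymptotics $\mathcal{Y}_j(\epsilon)\sim y_j\epsilon^{Y_j}$ with $Y_1\leq\cdots\leq Y_n$; (2) There exist $p=\sum_{j=0}^n p_j\mathsf{Y}^j\in\mathbb{C}[\mathsf{Y}]$ and $P=\bigoplus_{j=0}^nP_j\mathsf{Y}^j\in\mathbb{R}_{\min}[\mathsf{Y}]$ satisfying $\mathcal{P}_j(\epsilon)\simeq p_j\epsilon^{P_j}$ for $j=0,\ldots,n$, with $p_n=1$, $P_n=0$ (the min-plus unit), $p_0\neq0$ or $P_0=+\infty$, and $p_{n-i}\neq0$ for all $i\in\{1,\ldots,n-1\}$ such that $c_i<c_{i+1}$, where $(c_1\leq\cdots\leq c_n)=\mathsf{R}(P)$. When these assertions hold, we have $\mathsf{e}(\mathcal{P})\geq P$, $\overline{\mathsf{e}(\mathcal{P})}=\overline{P}$, and $$\mathsf{R}(\mathsf{e}(\mathcal{P}))=\mathsf{R}(P)=(c_1\leq\cdots\leq c_n)=(Y_1\leq\cdots\leq Y_n).$$ Moreover, if $c\in\mathbb{R}$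 is a root of $P$ with multiplicity $k$ and $c_i=\cdots=c_{i+k-1}=c$, then $y_i,\ldots,y_{i+k-1}$ are precisely the non-zero roots, counted with multiplicities, of the polynomial $$p^{(i)}=\sum_{0\leq j\leq n,\ \widehat{P}(c)=P_j+jc}p_j\mathsf{Y}^j\in\mathbb{C}[\mathsf{Y}].$$
   Context: The min-plus semiring $\mathbb{R}_{\min}$ is $\mathbb{R}\cup\{+\infty\}$ with addition $a\oplus b=\min(a,b)$ and multiplication $ab=a+b$ (zero element $+\infty$, unit $0$). $\mathcal{C}$ is the ring of germs at $0$ of continuous functions $f:(0,\epsilon_0)\to\mathbb{C}$ ($\epsilon_0>0$) such that $|f(\epsilon)|\leq\epsilon^{-k}$ on $(0,\epsilon_0)$ for some positive constant $k$. The exponent of $f\in\mathcal{C}$ is $\mathsf{e}(f)=\liminf_{\epsilon\to0}\frac{\log|f(\epsilon)|}{\log\epsilon}\in\mathbb{R}\cup\{+\infty\}$. For $f\in\mathcal{C}$, $b\in\mathbb{C}$, $B\in\mathbb{R}_{\min}$: $f(\epsilon)\simeq b\epsilon^B$ means $\lim_{\epsilon\to0}\epsilon^{-B}f(\epsilon)=b$ if $B\in\mathbb{R}$, and means $f=0$ (near $0$) if $B=+\infty$. A function $f\in\mathcal{C}$ has first order asymptotics $f(\epsilon)\sim b\epsilon^B$ if either $B\in\mathbb{R}$, $b\in\mathbb{C}\setminus\{0\}$ and $\lim_{\epsilon\to0}\epsilon^{-B}f(\epsilon)=b$, or $B=+\infty$ and $f=0$ near $0$. Statements about $\epsilon$ are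 understood for all sufficiently small $\epsilon>0$. For $\mathcal{P}=\sum_{j=0}^n\mathcal{P}_j\mathsf{Y}^j\in\mathcal{C}[\mathsf{Y}]$, $\mathsf{e}(\mathcal{P})=\bigoplus_{j=0}^n\mathsf{e}(\mathcal{P}_j)\mathsf{Y}^j\in\mathbb{R}_{\min}[\mathsf{Y}]$ is the min-plus polynomial of exponents. Formal min-plus polynomials are compared coefficientwise. For a formal min-plus polynomial $P$ of degree $n$: $\widehat{P}(y)=\min_k(P_k+ky)$ is its polynomial function; $\overline{P}$ is the formal polynomial with $\overline{P}_k=(\mathrm{vex}\,P)(k)$, where $\mathrm{vex}\,P$ is the convex hull of the function on $\mathbb{R}$ equal to $P_k$ at integers $k\geq 0$ and $+\infty$ elsewhere (equivalently $\overline{P}_k=\sup_{y\in\mathbb{R}}(-ky+\widehat{P}(y))$); $\mathsf{R}(P)=(c_1\leq\cdots\leq c_n)$ is the sequence of roots of $P$, i.e. the unique elements of $\mathbb{R}\cup\{+\infty\}$ such that $\widehat{P}(y)=P_n+\sum_{i=1}^n\min(y,c_i)$ for all $y$. The multiplicity of a root $c$ is $\#\{j: c_j=c\}$. *)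

(* Defs.v *)
From HB Require Import structures.
From mathcomp Require Import all_boot all_order all_algebra.
From mathcomp Require Import all_classical all_reals all_analysis.
From mathcomp Require Import complex.
Set Implicit Arguments.
Unset Strict Implicit.
Unset Printing Implicit Defensive.
Import Order.TTheory GRing.Theory Num.Theory.
Import numFieldNormedType.Exports.
Import ComplexField.Normc.
Local Open Scope classical_set_scope.
Local Open Scope ring_scope.
Local Open Scope complex_scope.

(* Germs at 0 are handled through representatives: an element of the ring of
   germs is given by a total function R -> R[i] satisfying [is_germ] (its
   values outside some ]0, e0[ are irrelevant), and equality of germs is
   equality for all sufficiently small positive arguments, i.e. along 0^'+.
   The canonical topology of a numFieldType is attached to its regular module
   R[i]^o, hence the type casts on codomains. *)
Section Germs.
Variable R : realType.
Implicit Types (f : R -> R[i]) (b : R[i]) (B : \bar R).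

Definition is_germ f : Prop :=
  exists e0 k : R, [/\ 0 < e0, 0 < k,
    {within `]0, e0[, continuous (f : R -> R[i]^o)} &
    forall e, 0 < e < e0 -> normc (f e) <= e `^ (- k)].

(* Since [lne 0 = -oo] and ln e < 0, the quotient is +oo where f vanishes. *)
Definition exponent f : \bar R :=
  limf_einf (fun e : R => (lne (normc (f e))%:E * ((ln e)^-1)%:E)%E) 0^'+.

Definition power_limit f b (B : R) : Prop :=
  (fun e : R => ((e `^ (- B))%:C * f e : R[i]^o)) @ 0^'+ --> (b : R[i]^o).

(* f(e) ~= b e^B, where b = 0 is allowed. In this relation and the next one
   B ranges over R \cup {+oo}: the value -oo is excluded. *)
Definition weak_asymp f b B : Prop :=
  match B with
  | B'%:E => power_limit f b B'
  | +oo%E => \forall e \near 0^'+, f e = 0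
  | -oo%E => False
  end.

(* f(e) ~ b e^B (first order asymptotics) *)
Definition asymp f b B : Prop :=
  match B with
  | B'%:E => b != 0 /\ power_limit f b B'
  | +oo%E => \forall e \near 0^'+, f e = 0
  | -oo%E => False
  end.

Definition poly_at n (Pc : 'I_n.+1 -> R -> R[i]) (e : R) : {poly R[i]} :=
  \sum_(j < n.+1) Pc j e *: 'X^j.

End Germs.

(* s lists the roots of q (resp. the nonzero roots of q) with multiplicities;
   q != 0 is required because [mup z 0] is not meaningful. *)
Definition root_list (F : fieldType) (q : {poly F}) (s : seq F) : Prop :=
  q != 0 /\ forall z, count_mem z s = mup z q.

Definition nonzero_root_list (F : fieldType) (q : {poly F}) (s : seq F) :
  Prop :=
  [/\ q != 0, 0 \notin s & forall z, z != 0 -> count_mem z s = mup z q].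

(* Convexity of an extended real function is convexity of its epigraph, and
   the convex hull of f is the greatest convex function below f. *)
Section Vex.
Variable R : realType.
Implicit Types f g : R -> \bar R.

Definition epigraph f : set (convex_lmodType (R^o * R^o)%type) :=
  [set u : R^o * R^o | (f u.1 <= u.2%:E)%E].

Definition vex f (x : R) : \bar R :=
  ereal_sup [set g x | g in [set g : R -> \bar R |
    convex_set (epigraph g) /\ forall z, (g z <= f z)%E]].

End Vex.

(* The min-plus semiring is the part of \bar R different from -oo, with
   addition [mine] (zero +oo) and multiplication [+%E] (unit 0); a formal
   min-plus polynomial P_0 (+) ... (+) P_n Y^n is given by the family of its
   coefficients. *)
Section MinPlus.
Variables (R : realType) (n : nat).
Implicit Types (P : 'I_n.+1 -> \bar R) (c : n.-tuple (\bar R)).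

Definition minplus_fun P (y : R) : \bar R :=
  \big[mine/+oo%E]_(k < n.+1) (P k + (k%:R * y)%:E)%E.

(* +oo off {0, ..., n} *)
Definition coef_fun P (x : R) : \bar R :=
  \big[mine/+oo%E]_(k < n.+1 | x == k%:R) P k.

Definition minplus_bar P (k : 'I_n.+1) : \bar R := vex (coef_fun P) k%:R.

Definition minplus_roots P c : Prop :=
  [/\ sorted <=%O c, -oo%E \notin c &
      forall y : R, minplus_fun P y =
        (P ord_max + \sum_(i < n) mine y%:E (tnth c i))%E].

End MinPlus.

Section Assertions.
Variables (R : realType) (n : nat).
Implicit Types (Pc : 'I_n.+1 -> R -> R[i]) (p : {poly R[i]}).
Implicit Types (P : 'I_n.+1 -> \bar R).

Definition root_asymp Pc (Yf : 'I_n -> R -> R[i])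
    (y : n.-tuple R[i]) (Y : n.-tuple (\bar R)) : Prop :=
  [/\ forall j, is_germ (Yf j),
      \forall e \near 0^'+, root_list (poly_at Pc e) [seq Yf j e | j : 'I_n],
      forall j, asymp (Yf j) (tnth y j) (tnth Y j) &
      sorted <=%O Y].

(* Sequences are indexed from 0: the i-th root c_i is the entry i.-1 of c. *)
Definition coef_asymp Pc p P (c : n.-tuple (\bar R)) : Prop :=
  [/\ (size p <= n.+1)%N /\ forall j, weak_asymp (Pc j) p`_j (P j),
      p`_n = 1 /\ P ord_max = 0%E,
      p`_0 != 0 \/ P ord0 = +oo%E,
      minplus_roots P c &
      forall i, (1 <= i <= n.-1)%N ->
        (nth +oo c i.-1 < nth +oo c i)%E -> p`_(n - i) != 0].

(* the terms of p at the indices j attaining the minimum in minplus_fun P y *)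
Definition saturated_part p P (y : R) : {poly R[i]} :=
  \sum_(j < n.+1 | minplus_fun P y == (P j + (j%:R * y)%:E)%E) p`_j *: 'X^j.

End Assertions.

(* Main.v *)
Require Import Defs.
From HB Require Import structures.
From mathcomp Require Import all_boot all_order all_algebra.
From mathcomp Require Import all_classical all_reals all_analysis.
From mathcomp Require Import complex perm ring lra zify.
Set Implicit Arguments.
Unset Strict Implicit.
Unset Printing Implicit Defensive.
Import Order.TTheory GRing.Theory Num.Theory.
Import numFieldNormedType.Exports.
Import ComplexField.Normc.
Local Open Scope classical_set_scope.
Local Open Scope ring_scope.
Local Open Scope complex_scope.

(** Write F(t) for the minimum P^(t) of the affine functions t |-> P_k + k t,
    which in both assertions is the sum over j of min(t, c_j) (here
    [sum_min c t]).  Everything follows from looking at the polynomial at a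
    fixed scale e^t, that is at e^(-F(t)) Pc(e, e^t z), and letting e tend to 0.

    From roots to coefficients.  If the roots behave like y_j e^(Y_j), this
    scaled polynomial is a product of n linear factors, each of which
    converges: to z when t < Y_j, to z - y_j when t = Y_j, to the constant
    - y_j when t > Y_j ([tends_scaled_coef]).  Comparing coefficients gives the
    asymptotics of the coefficients of Pc, with P_(n-i) = Y_1 + ... + Y_i
    ([roots_to_coefs]).  When asymptotics of the coefficients are also given, the
    limit of the scaled polynomial is also the saturated part of p at t, so the
    non-zero roots of that part are the y_j with Y_j = t
    ([saturated_limit_poly]).

    The role of the conditions on p.  The function F is affine on every
    interval free of the c_j, and there a single index k realizes the minimum,
    the others being worse by the distance to the nearest c_j
    ([minplus_vertex]).  The conditions imposed on p say exactly that p_k does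
    not vanish at these indices ([vertex_neq0]).  Hence the true exponents agree
    with P at the vertices of the Newton polygon and lie above P elsewhere:
    they have the same roots and the same convex minorants
    ([exponents_roots], [exponents_bar]).  As F determines the sequence of
    roots ([sum_min_uniq]), (c_j) and (Y_j) coincide.

    From coefficients to roots.  Two facts are needed.  The first is purely
    topological: the roots of a monic polynomial whose coefficients are
    continuous on a real interval can be numbered so that each of them is
    continuous ([continuous_roots]).  Roots are continuous as an unordered
    family; matching them optimally along a finite set of parameters gives
    numberings that satisfy an estimate independent of the finite set
    ([chain_bound]), and compactness of a product of finite sets produces one
    numbering that satisfies it everywhere.  The second fact is that any
    continuous root f has first order asymptotics.  By the vertex estimate,
    a non-zero root at e lies in one of finitely many annuli
    e^r / M <= |z| <= M e^r with r among the c_j ([root_annulus]); these are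
    disjoint for small e, so by connectedness f stays in one of them or
    vanishes identically ([single_scale]).  In the former case e^(-r) f(e)
    approaches the finite set of roots of the saturated part at r, and by
    connectedness again it converges to one of them ([scaled_root_limit]). *)

(** * Moduli and limits of complex functions *)

Section Conv.
Variable R : realType.
Implicit Types z w : R[i].

Lemma normcE z : `|z| = (normc z)%:C. Proof. by []. Qed.

Lemma normc_ge0 z : 0 <= normc z.
Proof. by rewrite -ler0c -normcE. Qed.

Lemma normc_real (x : R) : normc x%:C = `|x|.
Proof. by rewrite /normc /= expr0n addr0 sqrtr_sqr. Qed.

Lemma normcB z w : normc (z - w) = normc (w - z).
Proof. by rewrite -normcN opprB. Qed.

Lemma normcX z k : normc (z ^+ k) = normc z ^+ k.
Proof. by elim: k => [|k IH]; rewrite ?expr0 ?normc1 // !exprS normcM IH. Qed.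

Lemma normc_eq0 z : (normc z == 0) = (z == 0).
Proof. by apply/eqP/eqP => [/eq0_normc|->]; rewrite ?normc0. Qed.

Lemma normc_gt0 z : (0 < normc z) = (z != 0).
Proof. by rewrite lt_neqAle normc_ge0 andbT eq_sym normc_eq0. Qed.

Lemma le_normc_dist z w : normc z - normc w <= normc (z - w).
Proof. by rewrite lerBlDr; have := le_normcD (z - w) w; rewrite subrK. Qed.

Lemma normc_sum (I : Type) (r : seq I) (P : pred I) (F : I -> R[i]) :
  normc (\sum_(i <- r | P i) F i) <= \sum_(i <- r | P i) normc (F i).
Proof.
elim/big_rec2: _ => [|i x y _ le]; first by rewrite normc0.
by apply: (le_trans (le_normcD _ _)); rewrite lerD2l.
Qed.

End Conv.

Section Tends.
Variable R : realType.

(** Convergence measured by the real modulus: the norm of [R[i]] itself takes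
    values in [R[i]], which is inconvenient for estimates. *)
Definition tends (T : Type) (F : set_system T) (g : T -> R[i]) (b : R[i]) :=
  forall eta : R, 0 < eta -> \forall x \near F, normc (b - g x) < eta.

Variables (T : Type) (F : set_system T).
Context {FF : Filter F}.
Implicit Types (f g : T -> R[i]) (a b : R[i]).

Lemma tendsP f a : (f x : R[i]^o) @[x --> F] --> (a : R[i]^o) <-> tends F f a.
Proof.
split=> [/cvgr_dist_lt fa eta eta0|fa].
  have := fa eta%:C; rewrite ltcR => /(_ eta0).
  by apply: filterS => x; rewrite normcE ltcR.
apply/cvgrPdist_lt => eps eps0.
have epsE : eps = (complex.Re eps)%:C.
  by move: eps0; case: (eps) => u v; rewrite ltcE /= => /andP[/eqP -> _].
move: eps0; rewrite epsE ltcR => /fa.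
by apply: filterS => x; rewrite normcE ltcR.
Qed.

Lemma tends_near f g a : {near F, f =1 g} -> tends F f a -> tends F g a.
Proof. by move=> fg fa eta /fa; apply: filterS2 fg => x ->. Qed.

Lemma tends_eq f g a : f =1 g -> tends F f a -> tends F g a.
Proof. by move=> fg; apply: tends_near; near=> x; exact: fg. Unshelve. all: by end_near. Qed.

Lemma tends_cst a : tends F (fun=> a) a.
Proof. by move=> eta eta0; near=> x; rewrite subrr normc0. Unshelve. all: by end_near. Qed.

Lemma tendsD f g a b : tends F f a -> tends F g b ->
  tends F (fun x => f x + g x) (a + b).
Proof.
move=> fa gb eta eta0.
have e2 : 0 < eta / 2 by rewrite divr_gt0.
near=> x.
have -> : a + b - (f x + g x) = (a - f x) + (b - g x) by rewrite opprD addrACA.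
apply: (le_lt_trans (le_normcD _ _)); rewrite (splitr eta) ltrD //; near: x.
  exact: fa.
exact: gb.
Unshelve. all: by end_near. Qed.

Lemma tendsN f a : tends F f a -> tends F (fun x => - f x) (- a).
Proof.
by move=> fa eta /fa; apply: filterS => x; rewrite -opprD normcN.
Qed.

Lemma tendsM f g a b : tends F f a -> tends F g b ->
  tends F (fun x => f x * g x) (a * b).
Proof.
move=> fa gb eta eta0.
pose K := normc a + normc b + 1.
have K0 : 0 < K by have := normc_ge0 a; have := normc_ge0 b; rewrite /K; lra.
(* With both errors below d <= 1, the error on the product is at most
   d (|a| + |b| + d), and K absorbs the last d. *)
have [d [d0 d1 dK]] : exists d, [/\ 0 < d, d <= 1 & d * K <= eta].
  exists (Num.min 1 (eta / K)); rewrite lt_min ltr01 divr_gt0 //.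
  by rewrite -ler_pdivlMr // !ge_min !lexx orbT.
near=> x.
have ha : normc (a - f x) < d by near: x; exact: fa.
have hb : normc (b - g x) < d by near: x; exact: gb.
have -> : a * b - f x * g x = a * (b - g x) + (a - f x) * b - (a - f x) * (b - g x)
  by ring.
apply: (le_lt_trans (le_normcD _ _)); rewrite normcN [X in _ + X]normcM.
apply: (@le_lt_trans _ _ (normc a * normc (b - g x) + normc (a - f x) * normc b +
   normc (a - f x) * normc (b - g x))).
  by rewrite lerD2r; apply: (le_trans (le_normcD _ _)); rewrite !normcM.
have := normc_ge0 a; have := normc_ge0 b; have := normc_ge0 (a - f x).
have := normc_ge0 (b - g x); move: ha hb dK; rewrite /K.
set A := normc a; set B := normc b; set X := normc (a - _); set Y := normc (b - _).
by move=> hX hY hd Y0 X0 B0 A0; nra.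
Unshelve. all: by end_near. Qed.

Lemma tends_sum (I : Type) (r : seq I) (P : pred I) (f : I -> T -> R[i])
    (a : I -> R[i]) :
  (forall i, P i -> tends F (f i) (a i)) ->
  tends F (fun x => \sum_(i <- r | P i) f i x) (\sum_(i <- r | P i) a i).
Proof.
move=> h; elim: r => [|i r IH].
  by rewrite big_nil; apply: tends_eq (tends_cst 0) => x; rewrite big_nil.
rewrite big_cons; case: ifPn => Pi; last first.
  by apply: tends_eq IH => x; rewrite big_cons (negbTE Pi).
by apply: tends_eq (tendsD (h i Pi) IH) => x; rewrite big_cons Pi.
Qed.

Lemma tends_unique f a b : ProperFilter F -> tends F f a -> tends F f b -> a = b.
Proof.
move=> PF fa fb; apply/eqP; rewrite -subr_eq0 -normc_eq0; apply/negP => /negP ab.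
have ab0 : 0 < normc (a - b) / 2.
  by rewrite divr_gt0 // lt_neqAle eq_sym ab normc_ge0.
suff : \forall x \near F, False by move/filter_ex => [].
near=> x.
have h1 : normc (a - f x) < normc (a - b) / 2 by near: x; exact: fa.
have h2 : normc (b - f x) < normc (a - b) / 2 by near: x; exact: fb.
have : normc (a - b) <= normc (a - f x) + normc (b - f x).
  by rewrite (normcB b); apply: le_trans (le_normcD _ _); rewrite addrA subrK.
by lra.
Unshelve. all: by end_near. Qed.

End Tends.

(** * Continuity of the unordered roots *)

Section RootsContinuity.
Variables (R : realType) (T : Type) (F : set_system T).
Context {FF : Filter F}.
Implicit Types (s : seq R[i]).

Local Notation pr s := (\prod_(z <- s) ('X - z%:P)).

Lemma nearest_exists (a : R[i]) s : (0 < size s)%N ->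
  exists x, x \in s /\ forall z, z \in s -> normc (a - x) <= normc (a - z).
Proof.
elim: s => // x s IH _; case: s IH => [_|y s /(_ isT)[u [us uP]]].
  by exists x; rewrite mem_head; split => // z; rewrite inE => /eqP ->.
have [le|lt] := leP (normc (a - x)) (normc (a - u)).
  exists x; rewrite mem_head; split=> // z; rewrite inE => /orP[/eqP ->//|/uP].
  exact: le_trans.
exists u; rewrite inE us orbT; split=> // z; rewrite inE => /orP[/eqP ->|/uP//].
exact: ltW.
Qed.

(** Read contrapositively: a monic polynomial can be small at [a] only if one of
    its roots is close to [a]. *)
Lemma normc_horner_ge (a : R[i]) s (d : R) : 0 <= d ->
  (forall z, z \in s -> d <= normc (a - z)) -> d ^+ size s <= normc (pr s).[a].
Proof.
move=> d0; elim: s => [|z s IH] h; first by rewrite big_nil hornerE normc1 expr0.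
rewrite big_cons hornerM normcM exprS hornerXsubC ler_pM ?exprn_ge0 //.
  by apply: h; rewrite mem_head.
by apply: IH => y ys; apply: h; rewrite inE ys orbT.
Qed.

(** Synthetic division: read downwards from the leading coefficient, this
    recurrence computes the quotient [q] by ['X - x%:P] continuously from [x] and
    the dividend. *)
Lemma coef_divXsubC (q : {poly R[i]}) x k :
  q`_k = (('X - x%:P) * q)`_k.+1 + x * q`_k.+1.
Proof. by rewrite mulrBl coefB coefXM coefCM subrK. Qed.

(** Let [a] be a root of the limit.  The values of the polynomials at [a] tend
    to 0, so their root nearest to [a] tends to [a]; dividing it out leaves
    polynomials that converge coefficientwise to the limit divided by ['X - a],
    and induction on the degree applies. *)
Lemma tends_roots n (s : T -> seq R[i]) (w : seq R[i]) :
  size w = n -> (forall t, size (s t) = n) ->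
  (forall k, tends F (fun t => (pr (s t))`_k) (pr w)`_k) ->
  forall eta : R, 0 < eta -> \forall t \near F, exists s',
    perm_eq s' (s t) /\ forall i, (i < n)%N -> normc (w`_i - s'`_i) < eta.
Proof.
elim: n s w => [|n IH] s w sw ss ht eta eta0.
  by near=> t; exists (s t).
case: w sw ht => // a w [sw] ht.
have /choice[x xP] : forall t, exists x, x \in s t /\
    forall z, z \in s t -> normc (a - x) <= normc (a - z).
  by move=> t; apply: nearest_exists; rewrite ss.
have pE t : pr (s t) = ('X - (x t)%:P) * pr (rem (x t) (s t)).
  by rewrite (perm_big _ (perm_to_rem (xP t).1)) big_cons.
have hx : tends F x a.
  move=> d d0.
  have : tends F (fun t => (pr (s t)).[a]) (pr (a :: w)).[a].
    rewrite horner_coef size_prod_XsubC.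
    apply: (tends_eq (f := fun t => \sum_(i < (size (a :: w)).+1) (pr (s t))`_i * a ^+ i)).
      by move=> t; rewrite (@horner_coef _ (pr (s t))) size_prod_XsubC /= sw ss.
    by apply: tends_sum => i _; apply: tendsM (ht i) (tends_cst _).
  move=> /(_ (d ^+ n.+1) (exprn_gt0 _ d0)); apply: filterS => t.
  rewrite big_cons hornerM !hornerE subrr mul0r sub0r normcN.
  move=> lt; rewrite ltNge; apply/negP => le; move: lt; rewrite ltNge => /negP; apply.
  rewrite -(ss t); apply: normc_horner_ge (ltW d0) _ => z zs.
  exact: le_trans le ((xP t).2 z zs).
have hq k : tends F (fun t => (pr (rem (x t) (s t)))`_k) (pr w)`_k.
  have [m] := ubnP (n.+1 - k)%N; elim: m k => // m IHm k lem.
  have [nk|kn] := ltnP n k.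
    rewrite nth_default ?size_prod_XsubC ?sw //.
    apply: tends_eq (tends_cst 0) => t.
    by rewrite nth_default // size_prod_XsubC size_rem ?ss // (xP t).1.
  rewrite (coef_divXsubC _ a).
  apply: (tends_eq (f := fun t => (pr (s t))`_k.+1 + x t * (pr (rem (x t) (s t)))`_k.+1)).
    by move=> t; rewrite [RHS](coef_divXsubC _ (x t)) -pE.
  apply: tendsD; first by have := ht k.+1; rewrite big_cons.
  by apply: tendsM hx (IHm _ _); lia.
have := IH (fun t => rem (x t) (s t)) w sw _ hq eta eta0.
have srem t : size (rem (x t) (s t)) = n by rewrite size_rem ?ss ?(xP t).1.
move=> /(_ srem) IHe; near=> t.
have [s' [ps' hs']] : exists s', perm_eq s' (rem (x t) (s t)) /\
   forall i, (i < n)%N -> normc (w`_i - s'`_i) < eta by near: t.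
exists (x t :: s'); split.
  by rewrite perm_sym (permPl (perm_to_rem (xP t).1)) perm_cons perm_sym.
case=> [_|i /hs' //] /=; near: t; exact: hx.
Unshelve. all: by end_near. Qed.

End RootsContinuity.

(** * Continuous numbering of the roots *)

(** The product of copies of a finite set is compact: a family of binary
    constraints that can be met on every finite set of arguments can be met
    globally.  An ultrafilter on finite sets of arguments selects, for each
    argument, the value taken by most of the finite solutions. *)
Lemma compact_choice (A : eqType) (B : finType) (C : A -> A -> B -> B -> Prop) :
  (forall l : seq A, exists f : A -> B,
     forall a b, a \in l -> b \in l -> C a b (f a) (f b)) ->
  exists f : A -> B, forall a b, C a b (f a) (f b).
Proof.
move=> /choice[f fP].
pose G : set_system (seq A) :=
  [set X : set (seq A) |
    exists l0 : seq A, forall l : seq A, {subset l0 <= l} -> X l].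
have GF : ProperFilter G.
  split; first by move=> [l0 /(_ l0)]; apply.
  split; first by exists [::].
    move=> X Y [l1 X1] [l2 Y2]; exists (l1 ++ l2) => l sub; split.
      by apply: X1 => a al; apply: sub; rewrite mem_cat al.
    by apply: Y2 => a al; apply: sub; rewrite mem_cat al orbT.
  by move=> X Y XY [l0 X0]; exists l0 => l /X0 /XY.
have [U [UU GU]] := ultraFilterLemma GF.
have UF : ProperFilter U by exact: ultra_proper.
have mem_near a : \forall l \near U, a \in l.
  by apply: GU; exists [:: a] => l; apply; rewrite mem_head.
have /choice[g gP] : forall a, exists b, \forall l \near U, f l a = b.
  move=> a; apply: contrapT => /forallNP noB.
  have : \forall l \near U, forall b, ~ f l a = b.
    apply: filter_forall => b.
    by have [/noB//|] := in_ultra_setVsetC [set l | f l a = b] UU.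
  by move/filter_ex => [l /(_ (f l a))].
exists g => a b.
have : \forall l \near U, C a b (g a) (g b).
  near=> l.
  have <- : f l a = g a by near: l; exact: gP.
  have <- : f l b = g b by near: l; exact: gP.
  by apply: fP; near: l; exact: mem_near.
by move/filter_ex => [].
Unshelve. all: by end_near. Qed.

Section Matching.
Variables (R : realType) (n : nat).
Implicit Types (v w : 'I_n -> R[i]) (sg : 'S_n) (t u : R).

Definition match_cost (v w : 'I_n -> R[i]) (sg : 'S_n) : R :=
  \sum_i normc (v i - w (sg i)).

Definition best_match (v w : 'I_n -> R[i]) : 'S_n :=
  [arg min_(sg < (1%g : 'S_n)) match_cost v w sg]%O.

(** The distance between the unordered families underlying [v] and [w]. *)
Definition match_dist v w := match_cost v w (best_match v w).

Lemma match_dist_le v w sg : match_dist v w <= match_cost v w sg.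
Proof. by rewrite /match_dist /best_match; case: arg_minP => // i _; apply. Qed.

Lemma normc_le_cost v w sg i : normc (v i - w (sg i)) <= match_cost v w sg.
Proof.
rewrite /match_cost (bigD1 i) //= lerDl.
by apply: sumr_ge0 => j _; exact: normc_ge0.
Qed.

Lemma normc_best_match v w i :
  normc (v i - w (best_match v w i)) <= match_dist v w.
Proof. exact: normc_le_cost. Qed.

Lemma match_dist_sym v w : match_dist v w = match_dist w v.
Proof.
wlog suff : v w / match_dist v w <= match_dist w v.
  by move=> h; apply/le_anti; rewrite !h.
apply: (le_trans (match_dist_le v w (best_match w v)^-1%g)).
rewrite /match_dist /match_cost (reindex_perm (best_match w v)) /=.
by apply: ler_sum => i _; rewrite permK normcB.
Qed.

Lemma match_dist_triangle v w x :
  match_dist v x <= match_dist v w + match_dist w x.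
Proof.
apply: (le_trans (match_dist_le v x (best_match v w * best_match w x)%g)).
rewrite /match_dist /match_cost [X in _ + X](reindex_perm (best_match v w)) /=.
rewrite -big_split /=; apply: ler_sum => i _.
rewrite permM; apply: le_trans (le_normcD _ _).
by rewrite addrA subrK.
Qed.

Lemma match_dist_refl v : match_dist v v = 0.
Proof.
apply/le_anti/andP; split.
  apply: (le_trans (match_dist_le v v 1%g)).
  by rewrite /match_cost big1 // => i _; rewrite perm1 subrr normc0.
by apply: sumr_ge0 => i _; exact: normc_ge0.
Qed.

End Matching.

Section Selection.
Variables (R : realType) (n : nat) (s : R -> 'I_n -> R[i]).
Implicit Types (t u v x y : R).

(** The numbering [f] follows the points of the family from [t] to [u]. *)
Let matched (f : R -> 'S_n) : rel R := fun t u =>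
  [forall i, normc (s t (f t i) - s u (f u i)) <= match_dist (s t) (s u)].

(** The permutation at the new head is forced by the one at the next point and
    an optimal matching between the two. *)
Lemma matched_chain (l : seq R) : uniq l -> exists f, sorted (matched f) l.
Proof.
elim: l => [|t l IH] /=; first by exists (fun=> 1%g).
move=> /andP[tl /IH[f fl]].
case: l tl {IH} fl => [|u l] tl fl; first by exists f.
pose pi := best_match (s t) (s u).
pose f' := fun x => if x == t then (f u * pi^-1)%g else f x.
have f'E x : x \in u :: l -> f' x = f x.
  by rewrite /f'; case: eqP => // -> /(negP tl).
exists f'; rewrite /=; apply/andP; split; last first.
  suff -> : path (matched f') u l = path (matched f) u l by [].
  apply: (@eq_in_path _ (mem (u :: l))); last exact/allP.
  by move=> x y xl yl; rewrite /matched !f'E.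
apply/forallP => i; rewrite (f'E u) ?mem_head // /f' eqxx permM.
by have := normc_best_match (s t) (s u) (pi^-1%g (f u i)); rewrite -/pi permKV.
Qed.

(** A shortest path in the graph visits each of the [n] vertices at most once. *)
Lemma connect_dist (v : 'I_n -> R[i]) (d : R) i j : 0 <= d ->
  connect (fun i j => normc (v i - v j) <= d) i j ->
  normc (v i - v j) <= n%:R * d.
Proof.
move=> d0 /connectP[p pp ->]; case/shortenP: pp => {}p pp up _.
have sp : (size p <= n)%N.
  have /= cp := card_uniqP up.
  by apply: ltnW; rewrite -cp -[leqRHS]card_ord max_card.
apply: (@le_trans _ _ ((size p)%:R * d)); last by rewrite ler_wpM2r // ler_nat.
elim: p i pp {up sp} => [|k p IH] i /=; first by rewrite subrr normc0 mul0r.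
move=> /andP[ik /IH kp].
have -> : v i - v (last k p) = (v i - v k) + (v k - v (last k p)) by rewrite addrA subrK.
by rewrite -natr1 mulrDl mul1r; apply: (le_trans (le_normcD _ _)); rewrite [leLHS]addrC lerD.
Qed.

(** Along a chain that stays [eta]-close to [s t], the [i]-th point remains near
    the connected component of its starting point in the graph that joins the
    points of [s t] at mutual distance at most [4 * eta].  Indeed a step moves it
    by at most [2 * eta], and both ends of the step are within [eta] of points
    of [s t]. *)
Let near_reach (f : R -> 'S_n) (eta : R) t i u := exists2 j,
  connect (fun i j => normc (s t i - s t j) <= 4 * eta) (f t i) j &
  normc (s t j - s u (f u i)) <= eta.

Lemma near_reach_path f (eta : R) t i x l : path (matched f) x l ->
  (forall u, u \in x :: l -> match_dist (s t) (s u) <= eta) ->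
  near_reach f eta t i x -> forall u, u \in x :: l -> near_reach f eta t i u.
Proof.
elim: l x => [|y l IH] x /=; first by move=> _ _ h u; rewrite inE => /eqP ->.
move=> /andP[xy pl] hd [j ij jx] u.
rewrite inE => /orP[/eqP ->|]; first by exists j.
apply: IH => // [v vl|]; first by apply: hd; rewrite inE vl orbT.
have hx : match_dist (s t) (s x) <= eta by rewrite hd // mem_head.
have hy : match_dist (s t) (s y) <= eta by rewrite hd // !inE eqxx orbT.
pose k := ((best_match (s t) (s y))^-1)%g (f y i).
have ky : normc (s t k - s y (f y i)) <= eta.
  by apply: le_trans hy; have := normc_best_match (s t) (s y) k; rewrite /k permKV.
exists k => //; apply: connect_trans ij (connect1 _).
have xyi := forallP xy i.
have := match_dist_triangle (s x) (s t) (s y); rewrite (match_dist_sym (s x) (s t)) => tri.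
have -> : s t j - s t k = (s t j - s x (f x i)) + (s x (f x i) - s y (f y i))
   - (s t k - s y (f y i)) by ring.
apply: (le_trans (le_normcD _ _)); rewrite normcN.
have := le_normcD (s t j - s x (f x i)) (s x (f x i) - s y (f y i)).
by lra.
Qed.

(** The length of the chain does not enter the bound; this is what allows
    passing from finite sets of parameters to all of them. *)
Lemma chain_bound f t l (eta : R) : path (matched f) t l ->
  (forall u, u \in t :: l -> match_dist (s t) (s u) <= eta) ->
  forall u i, u \in t :: l ->
    normc (s t (f t i) - s u (f u i)) <= (4 * n%:R + 1) * eta.
Proof.
move=> pl hd u i ul.
have eta0 : 0 <= eta by rewrite -(match_dist_refl (s t)) hd // mem_head.
have [|j ij ju] := near_reach_path (i := i) pl hd _ ul.
  by exists (f t i); rewrite ?connect0 // subrr normc0.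
have := connect_dist _ ij; rewrite mulr_ge0 // => /(_ isT) le.
have -> : s t (f t i) - s u (f u i) = (s t (f t i) - s t j) + (s t j - s u (f u i))
  by rewrite addrA subrK.
by apply: (le_trans (le_normcD _ _)); lra.
Qed.

(** [chain_bound] is a constraint on pairs of parameters, and [matched_chain]
    meets it on every finite set, sorted increasingly. *)
Lemma coherent_choice : exists f : R -> 'S_n, forall t u (eta : R), t <= u ->
  (forall v, t <= v <= u -> match_dist (s t) (s v) <= eta) ->
  forall i, normc (s t (f t i) - s u (f u i)) <= (4 * n%:R + 1) * eta.
Proof.
pose C (t u : R) (p q : 'S_n) := forall eta : R, t <= u ->
  (forall v, t <= v <= u -> match_dist (s t) (s v) <= eta) ->
  forall i, normc (s t (p i) - s u (q i)) <= (4 * n%:R + 1) * eta.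
suff [f fP] : exists f, forall t u, C t u (f t) (f u) by exists f => t u; exact: fP.
apply: compact_choice => l.
pose l' := sort <=%R (undup l).
have ul' : uniq l' by rewrite sort_uniq undup_uniq.
have sl' : sorted <=%R l' by apply: sort_sorted; exact: le_total.
have ml' x : (x \in l') = (x \in l) by rewrite mem_sort mem_undup.
have [f fP] := matched_chain ul'.
exists f => t u; rewrite -!ml' => tl ul eta tu hd i.
move: sl'; rewrite (sorted_pairwise le_trans) => sl'.
case/splitPr : {ml'}l' / tl ul ul' sl' fP => l1 l2 ul ull.
rewrite pairwise_cat /= => /and3P[/allrelP le12 _ /andP[/allP le2 sl2]].
move=> /cat_sorted2[_ /= pt].
have {ul} : u \in t :: l2.
  move: ul; rewrite mem_cat => /orP[ul1|//].
  suff -> : u = t by rewrite mem_head.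
  by apply/le_anti; rewrite tu andbT; apply: le12 => //; rewrite mem_head.
rewrite inE => /orP[/eqP ->|ul2].
  apply: (chain_bound (l := [::])); rewrite ?mem_head // => v.
  by rewrite inE => /eqP ->; apply: hd; rewrite lexx.
case/splitPr : l2 / ul2 ull le12 le2 sl2 pt => l3 l4 _ _ le2.
rewrite pairwise_cat => /and3P[/allrelP le34 _ _].
rewrite -cat_rcons cat_path => /andP[pt _].
apply: (chain_bound pt); last by rewrite inE mem_rcons mem_head orbT.
move=> v; rewrite inE => /orP[/eqP ->|vl]; first by apply: hd; rewrite lexx.
apply: hd; apply/andP; split.
  by apply: le2; rewrite -cat_rcons mem_cat vl.
move: vl; rewrite mem_rcons inE => /orP[/eqP -> //|vl].
by apply: le34; rewrite ?mem_head.
Qed.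

Lemma continuous_choice (I : set R) :
  (forall t, I t -> forall eta : R, 0 < eta ->
     \forall u \near t, match_dist (s t) (s u) < eta) ->
  exists f : R -> 'S_n, forall t, I t -> forall i,
    tends (nbhs t) (fun u => s u (f u i)) (s t (f t i)).
Proof.
move=> hd; have [f fP] := coherent_choice; exists f => t It i eta eta0.
set K : R := 4 * n%:R + 1 in fP; have K0 : 0 < K by rewrite ltr_pwDr // mulr_ge0.
have [d d0 dK] : exists2 d : R, 0 < d & K * (2 * d) < eta.
  exists (eta / (4 * K)); first by rewrite divr_gt0 // mulr_gt0.
  have -> : K * (2 * (eta / (4 * K))) = eta / 2 by field; rewrite gt_eqF.
  by lra.
have /nbhs_ballP[r /= r0 hr] := hd t It _ d0.
have near_t v : `|t - v| < r -> match_dist (s t) (s v) < d by move/hr.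
apply/nbhs_ballP; exists r => //= u; rewrite /ball /= => tu.
have [le|/ltW le] := leP t u.
  apply: (le_lt_trans (fP t u d le _ i)); last first.
    by apply: le_lt_trans dK; rewrite ler_pM2l //; lra.
  move=> v /andP[tv vu]; apply/ltW/near_t; apply: le_lt_trans tu.
  by rewrite !(distrC t) !ger0_norm ?subr_ge0 // lerD2r.
(* When u < t the estimate starts from u: the triangle inequality through t
   costs the factor 2. *)
rewrite normcB; apply: le_lt_trans (fP u t (2 * d) le _ i) dK.
move=> v /andP[uv vt]; apply: (le_trans (match_dist_triangle _ (s t) _)).
have hu := near_t u tu; have hv : match_dist (s t) (s v) < d.
  by apply: near_t; apply: le_lt_trans tu; rewrite !ger0_norm ?subr_ge0 // lerD2l lerN2.
by rewrite match_dist_sym; lra.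
Qed.

End Selection.

Lemma perm_eq_nthP (T : eqType) (x0 : T) n (s1 s2 : seq T) :
  size s2 = n -> perm_eq s1 s2 ->
  exists p : 'S_n, forall i : 'I_n, nth x0 s1 i = nth x0 s2 (p i).
Proof.
move=> <- /(@tuple_permP _ _ _ (in_tuple s2))[p s1E]; exists p => i.
by rewrite s1E (nth_map i) ?size_enum_ord // nth_ord_enum (tnth_nth x0).
Qed.

(** A numbering that is continuous for the unordered distance, as given by
    [tends_roots], can be chosen continuous in each entry. *)
Lemma continuous_roots (R : realType) n (I : set R) (q : R -> {poly R[i]}) :
  open I ->
  (forall t, I t -> q t \is monic /\ size (q t) = n.+1) ->
  (forall t, I t -> forall k, tends (nbhs t) (fun u => (q u)`_k) (q t)`_k) ->
  exists Y : 'I_n -> R -> R[i], forall t, I t ->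
    q t = \prod_(i < n) ('X - (Y i t)%:P) /\
    forall i, tends (nbhs t) (Y i) (Y i t).
Proof.
move=> oI qmon qcont.
have /choice[r rP] : forall t, exists r : seq R[i],
    size r = n /\ (I t -> q t = \prod_(z <- r) ('X - z%:P)).
  move=> t; have [It|nIt] := pselect (I t); last by exists (nseq n 0); rewrite size_nseq.
  have [/monicP lead sz] := qmon t It; have [r rE] := closed_field_poly_normal (q t).
  exists r; move: rE; rewrite lead scale1r => rE; split => //.
  by apply: succn_inj; rewrite -sz rE size_prod_XsubC.
pose s t (i : 'I_n) := nth 0 (r t) i.
have sdist t : I t -> forall eta : R, 0 < eta ->
    \forall u \near t, match_dist (s t) (s u) < eta.
  move=> It eta eta0.
  have e0 : 0 < eta / n.+1%:R by rewrite divr_gt0.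
  have := tends_roots (F := nbhs t) (s := r) (w := r t) (rP t).1 (fun u => (rP u).1) _ e0.
  have near_I : \forall u \near t, I u by move/open_nbhs_nbhs: (conj oI It).
  have h k : tends (nbhs t) (fun u => (\prod_(z <- r u) ('X - z%:P))`_k)
      (\prod_(z <- r t) ('X - z%:P))`_k.
    rewrite -(rP t).2 //; apply: tends_near (qcont t It k).
    by apply: filterS near_I => u Iu; rewrite (rP u).2.
  move=> /(_ _ h); apply: filterS => u [s' [/(perm_eq_nthP 0 (rP u).1)[p pE] hs']].
  apply: (le_lt_trans (match_dist_le _ _ p)).
  apply: (@le_lt_trans _ _ (\sum_(i < n) (eta / n.+1%:R))).
    by apply: ler_sum => i _; rewrite /s -pE; apply/ltW/hs'.
  rewrite sumr_const card_ord -[X in X < _]mulr_natr mulrAC ltr_pdivrMr //.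
  by rewrite ltr_pM2l // ltr_nat.
have [f fP] := continuous_choice sdist.
exists (fun i t => s t (f t i)) => t It; split; last exact: fP.
have [sz ->//] := rP t.
rewrite (big_nth 0) sz big_mkord (reindex_perm (f t)).
by apply: eq_bigr => i _.
Qed.

(** * Roots of min-plus polynomials *)

Section MinPlusTheory.
Variable R : realType.
Implicit Types (s t y d : R) (x : \bar R).

(** Real-valued, because [y] is finite and root sequences avoid [-oo]. *)
Definition rmin y x : R := fine (mine y%:E x).

Lemma rmin_ge y x : (y%:E <= x)%E -> rmin y x = y.
Proof. by move=> yx; rewrite /rmin min_l. Qed.

Lemma rmin_le y r : r <= y -> rmin y r%:E = r.
Proof. by move=> yx; rewrite /rmin min_r. Qed.

Lemma rmin_EFin y x : x != -oo%E -> (rmin y x)%:E = mine y%:E x.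
Proof.
case: x => [r| |] // _; last by rewrite rmin_ge ?leey // min_l ?leey.
by have [le|/ltW le] := leP r y; [rewrite rmin_le // min_r | rewrite rmin_ge // min_l].
Qed.

Lemma gap_exists (l : seq (\bar R)) s : exists2 d, 0 < d &
  forall x, x \in l -> [\/ x = s%:E, (x <= (s - 2 * d)%:E)%E | ((s + 2 * d)%:E <= x)%E].
Proof.
elim: l => [|x l [d d0 IH]]; first by exists 1.
have [e e0 xe] : exists2 e, 0 < e &
    [\/ x = s%:E, (x <= (s - 2 * e)%:E)%E | ((s + 2 * e)%:E <= x)%E].
  case: x => [r| |]; last 2 first.
  - by exists 1 => //; apply: Or33; rewrite leey.
  - by exists 1 => //; apply: Or32; rewrite leNye.
  have [lt|lt|->] := ltgtP r s; last by exists 1 => //; apply: Or31.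
    by exists ((s - r) / 2); [lra|apply: Or32; rewrite lee_fin; lra].
  by exists ((r - s) / 2); [lra|apply: Or33; rewrite lee_fin; lra].
exists (Num.min d e); first by rewrite lt_min d0.
have md : Num.min d e <= d by rewrite ge_min lexx.
have me : Num.min d e <= e by rewrite ge_min lexx orbT.
move=> z; rewrite inE => /orP[/eqP ->|/IH].
  case: xe => h; [exact: Or31|apply: Or32|apply: Or33].
    by apply: (le_trans h); rewrite lee_fin; lra.
  by apply: le_trans h; rewrite lee_fin; lra.
case=> h; [exact: Or31|apply: Or32|apply: Or33].
  by apply: (le_trans h); rewrite lee_fin; lra.
by apply: le_trans h; rewrite lee_fin; lra.
Qed.

Variable n : nat.
Implicit Types (P : 'I_n.+1 -> \bar R) (c : n.-tuple (\bar R)).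

Definition sum_min c y : R := \sum_(i < n) rmin y (tnth c i).

Definition count_below c y : nat := count (fun x => x <= y%:E)%E c.

Lemma count_below_le c y : (count_below c y <= n)%N.
Proof. by rewrite -[leqRHS](size_tuple c) count_size. Qed.

Lemma minplus_rootsE P c : P ord_max = 0%E -> minplus_roots P c ->
  forall y, minplus_fun P y = (sum_min c y)%:E.
Proof.
move=> P0 [_ cN h] y; rewrite h P0 add0e /sum_min -sumEFin; apply: eq_bigr => i _.
by rewrite rmin_EFin //; apply: contraNneq cN => <-; exact: mem_tnth.
Qed.

Lemma minplus_fun_le P y (k : 'I_n.+1) :
  (minplus_fun P y <= P k + (k%:R * y)%:E)%E.
Proof. exact: (bigmin_le +oo%E k). Qed.

Lemma minplus_funP P y r :
  (forall k : 'I_n.+1, r%:E <= P k + (k%:R * y)%:E)%E ->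
  (exists k : 'I_n.+1, P k + (k%:R * y)%:E <= r%:E)%E -> minplus_fun P y = r%:E.
Proof.
move=> lb [k ub]; apply/le_anti; rewrite (le_trans (minplus_fun_le P y k) ub) /=.
by apply: le_bigmin => [|j _]; rewrite ?leey.
Qed.

Lemma minplus_fun_attained P y r : minplus_fun P y = r%:E ->
  exists k : 'I_n.+1, (P k + (k%:R * y)%:E = r%:E)%E.
Proof.
move=> h.
have := @eq_bigmin _ (\bar R) 'I_n.+1 +oo%E ord0 predT (fun k => P k + (k%:R * y)%:E)%E isT.
case=> [|k _]; first by move=> i _; rewrite leey.
by rewrite -/(minplus_fun P y) h => ->; exists k.
Qed.

Lemma minplus_roots_sum_min P c : P ord_max = 0%E ->
  sorted <=%O c -> -oo%E \notin c ->
  (forall y, minplus_fun P y = (sum_min c y)%:E) -> minplus_roots P c.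
Proof.
move=> P0 sc cN h; split => // y; rewrite h P0 add0e /sum_min -sumEFin.
apply: eq_bigr => i _.
by rewrite rmin_EFin //; apply: contraNneq cN => <-; exact: mem_tnth.
Qed.

(** On such an interval [sum_min c] is affine, with slope the number of entries
    of [c] above it. *)
Definition gap c s d := forall x, x \in val c ->
  (x <= (s - d)%:E)%E \/ ((s + d)%:E <= x)%E.

Lemma rmin_gap x s d t : -oo%E != x -> `|t - s| <= d ->
  (x <= (s - d)%:E)%E \/ ((s + d)%:E <= x)%E ->
  rmin t x = rmin s x + (~~ (x <= (s - d)%:E)%E)%:R * (t - s).
Proof.
rewrite ler_norml => xN /andP[h1 h2].
have d0 : 0 <= d by lra.
case=> h.
  case: x h xN => [r| |] //; rewrite lee_fin => h _.
  by rewrite h mul0r addr0 !rmin_le //; lra.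
have [h'|h'] := boolP (x <= (s - d)%:E)%E.
  have d00 : d = 0 by have := le_trans h h'; rewrite lee_fin; lra.
  have -> : t = s by lra.
  by rewrite mul0r addr0.
rewrite mul1r !rmin_ge; first by rewrite addrC subrK.
  by apply: le_trans h; rewrite lee_fin; lra.
by apply: le_trans h; rewrite lee_fin; lra.
Qed.

Lemma sum_min_gap c s d t : -oo%E \notin c -> gap c s d -> `|t - s| <= d ->
  sum_min c t = sum_min c s + (n - count_below c (s - d))%:R * (t - s).
Proof.
move=> cN gc td; rewrite /sum_min.
rewrite (eq_bigr (fun i => rmin s (tnth c i) +
    (~~ (tnth c i <= (s - d)%:E)%E)%:R * (t - s))); last first.
  move=> i _; apply: rmin_gap (td) (gc _ (mem_tnth i c)).
  by apply: contraNneq cN => ->; exact: mem_tnth.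
rewrite big_split /= -mulr_suml; congr (_ + _ * _).
have -> : (n - count_below c (s - d) = count (fun x => ~~ (x <= (s - d)%:E)%E) c)%N.
  rewrite -[X in (X - _)%N](size_tuple c) -(count_predC (fun x => x <= (s - d)%:E)%E c).
  by rewrite addKn.
rewrite -sum1_count big_tuple natr_sum [RHS]big_mkcond /=.
by apply: eq_bigr => i _; case: ifP.
Qed.

(** At the first index where two sorted sequences differ, pick [y] strictly
    above the smaller entry but not above the larger one: all later entries of
    the second sequence contribute [y], the best possible. *)
Lemma sum_min_uniq c1 c2 : sorted <=%O c1 -> sorted <=%O c2 ->
  -oo%E \notin c1 -> -oo%E \notin c2 -> sum_min c1 =1 sum_min c2 -> c1 = c2.
Proof.
move=> s1 s2 N1 N2 h; apply/val_inj/(@eq_from_nth _ +oo%E).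
  by rewrite !size_tuple.
move=> i; rewrite size_tuple; have [m] := ubnP i; elim: m i => // m IH i im lin.
have {}IH j : (j < i)%N -> nth +oo%E c1 j = nth +oo%E c2 j.
  by move=> ji; apply: IH; lia.
wlog lt : c1 c2 s1 s2 N1 N2 h IH / (nth +oo%E c1 i < nth +oo%E c2 i)%E.
  move=> wl; have [lt|lt|//] := ltgtP (nth +oo%E c1 i) (nth +oo%E c2 i).
    exact: wl.
  by apply/esym/wl => // j /IH ->.
exfalso.
have [y /andP[y1 y2]] : exists y, ((nth +oo%E c1 i < y%:E) && (y%:E <= nth +oo%E c2 i))%E.
  have : nth +oo%E c1 i != -oo%E.
    by apply: contraNneq N1 => <-; rewrite mem_nth // size_tuple.
  case: (nth +oo%E c1 i) lt => [r| |] //; last by rewrite ltNge leey.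
  case: (nth +oo%E c2 i) => [r'| |] // rr' _; first by exists r'; rewrite rr' lexx.
  by exists (r + 1); rewrite lte_fin leey andbT; lra.
have := h y; apply/eqP; rewrite lt_eqF // /sum_min.
have tn (c : n.-tuple (\bar R)) (j : 'I_n) : tnth c j = nth +oo%E c j by exact: tnth_nth.
pose j0 := Ordinal lin.
have c0N (c : n.-tuple (\bar R)) (j : 'I_n) : -oo%E \notin c -> tnth c j != -oo%E.
  by apply: contraNneq => <-; exact: mem_tnth.
have key (j : 'I_n) : rmin y (tnth c1 j) <= rmin y (tnth c2 j).
  have [ji|ij] := ltnP j i; first by rewrite !tn IH.
  rewrite [leRHS]rmin_ge; last first.
    by rewrite tn; apply: le_trans y2 _; apply: (sorted_leq_nth le_trans le_refl _ s2);
      rewrite ?inE ?size_tuple.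
  by rewrite -lee_fin rmin_EFin ?c0N // ge_min lexx.
rewrite (bigD1 j0) //= [ltRHS](bigD1 j0) //=; apply: ltr_leD; last exact: ler_sum.
rewrite [ltRHS]rmin_ge; last by rewrite tn.
by rewrite -lte_fin rmin_EFin ?c0N // tn gt_min y1 orbT.
Qed.

End MinPlusTheory.

(** * Power asymptotics and exponents *)

Section Powers.
Variable R : realType.
Implicit Types (f : R -> R[i]) (b : R[i]) (B : R) (e : R).

Lemma near_right (r : R) : 0 < r -> \forall e \near 0^'+, 0 < e < r.
Proof.
move=> r0; near=> e; apply/andP; split; first by near: e; exact: nbhs_right_gt.
by near: e; exact: nbhs_right_lt.
Unshelve. all: by end_near. Qed.

Lemma near_right_ex (P : R -> Prop) : (\forall e \near 0^'+, P e) ->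
  exists2 r, 0 < r & forall e, 0 < e < r -> P e.
Proof.
move=> /nbhs_ballP[r /= r0 h]; exists r => // e /andP[e0 er].
by apply: h => //; rewrite /ball /= sub0r normrN gtr0_norm.
Qed.

Lemma near_powR_small (a d : R) : 0 < d -> 0 < a ->
  \forall e \near 0^'+, e `^ d < a.
Proof.
move=> d0 a0; have := powR_cvg0 d0.
move=> /cvgr_lt /(_ _ a0); exact.
Qed.

Lemma near_ln_lt (M : R) : \forall e \near 0^'+, 0 < e < 1 /\ ln e < M.
Proof.
have := near_right (r := Num.min 1 (expR M)).
rewrite lt_min ltr01 expR_gt0 => /(_ isT); apply: filterS => e.
rewrite lt_min => /and3P[e0 e1 eM]; rewrite e0 e1; split=> //.
by rewrite -[M]expRK ltr_ln // posrE expR_gt0.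
Qed.

Lemma power_limitP f b B :
  power_limit f b B <-> tends 0^'+ (fun e => (e `^ (- B))%:C * f e) b.
Proof. exact: tendsP. Qed.

Lemma normc_scaled f B e : 0 < e ->
  normc ((e `^ (- B))%:C * f e) = normc (f e) / e `^ B.
Proof.
by move=> e0; rewrite normcM normc_real ger0_norm ?powR_ge0 // powRN mulrC.
Qed.

Lemma power_limit_ub f b B : power_limit f b B ->
  \forall e \near 0^'+, normc (f e) <= (normc b + 1) * e `^ B.
Proof.
move=> /power_limitP /(_ 1 ltr01) h; near=> e.
have e0 : 0 < e by near: e; exact: nbhs_right_gt.
rewrite -ler_pdivrMr ?powR_gt0 // -normc_scaled //.
have hb : normc (b - (e `^ (- B))%:C * f e) < 1 by near: e.
have := le_normc_dist ((e `^ (- B))%:C * f e) b; rewrite (normcB _ b); lra.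
Unshelve. all: by end_near. Qed.

Lemma power_limit_lb f b B : power_limit f b B -> b != 0 ->
  \forall e \near 0^'+, normc b / 2 * e `^ B <= normc (f e).
Proof.
move=> /power_limitP h b0.
have nb : 0 < normc b by rewrite normc_gt0.
have nb2 : 0 < normc b / 2 by rewrite divr_gt0.
near=> e.
have e0 : 0 < e by near: e; exact: nbhs_right_gt.
rewrite -ler_pdivlMr ?powR_gt0 // -normc_scaled //.
have hb : normc (b - (e `^ (- B))%:C * f e) < normc b / 2 by near: e; exact: h.
have := le_normc_dist b ((e `^ (- B))%:C * f e); lra.
Unshelve. all: by end_near. Qed.

Local Notation expo f e := (lne (normc (f e))%:E * ((ln e)^-1)%:E)%E.

(** A factor [C] contributes [ln C / ln e] to the exponent, which is negligible
    as soon as [ln e] is negative enough. *)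
Lemma expo_ge f e (C B eta : R) : 0 < e < 1 -> 0 < C -> 0 < eta ->
  ln e < - (ln C / eta) -> normc (f e) <= C * e `^ B ->
  ((B - eta)%:E <= expo f e)%E.
Proof.
move=> e01 C0 eta0 le_ln fC.
have ln0 : (ln e)^-1 < 0 by rewrite invr_lt0 ln_lt0.
have /andP[e0 e1] := e01.
rewrite /lne; case: ifPn => [_|]; first by rewrite mulNyr ltr0_sg // mulN1e leey.
rewrite -ltNge => f0; rewrite -EFinM lee_fin ler_ndivlMr ?ln_lt0 //.
rewrite -ler_ln ?posrE ?mulr_gt0 ?powR_gt0 // lnM ?posrE ?powR_gt0 // ln_powR in fC.
move: le_ln; rewrite ltrNr ltr_pdivrMr // => h; nra.
Qed.

Lemma expo_le f e (C B eta : R) : 0 < e < 1 -> 0 < C -> 0 < eta ->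
  ln e < ln C / eta -> C * e `^ B <= normc (f e) ->
  (expo f e <= (B + eta)%:E)%E.
Proof.
move=> e01 C0 eta0 le_ln fC.
have /andP[e0 e1] := e01.
have ln0 : (ln e)^-1 < 0 by rewrite invr_lt0 ln_lt0.
have f0 : 0 < normc (f e) by apply: lt_le_trans fC; rewrite mulr_gt0 ?powR_gt0.
rewrite /lne [_ <= 0]leNgt f0 /= -EFinM lee_fin ler_ndivrMr ?ln_lt0 //.
rewrite -ler_ln ?posrE ?mulr_gt0 ?powR_gt0 // lnM ?posrE ?powR_gt0 // ln_powR in fC.
move: le_ln; rewrite ltr_pdivlMr // => h; nra.
Qed.

Lemma limf_einf_ge (F : set_system R) {FF : Filter F} (g : R -> \bar R)
    (B : \bar R) : (\forall e \near F, (B <= g e)%E) -> (B <= limf_einf g F)%E.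
Proof.
move=> h; rewrite limf_einfE; apply: le_ereal_sup_tmp.
exists (ereal_inf [set g x | x in [set e | (B <= g e)%E]]); first by eexists; first exact: h.
by apply: le_ereal_inf_tmp => _ [e /= ? <-].
Qed.

Lemma limf_einf_le (F : set_system R) {FF : ProperFilter F} (g : R -> \bar R)
    (B : \bar R) : (\forall e \near F, (g e <= B)%E) -> (limf_einf g F <= B)%E.
Proof.
move=> h; rewrite limf_einfE; apply: ge_ereal_sup => _ [V FV <-].
have /filter_ex[e [Ve ge]] : \forall e \near F, V e /\ (g e <= B)%E.
  by apply: filterS2 h FV.
by apply: ge_ereal_inf; exists (g e) => //; exists e.
Qed.

(** Only an inequality holds here, as the coefficient [b] may vanish. *)
Lemma le_exponent f b (B : \bar R) : weak_asymp f b B -> (B <= exponent f)%E.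
Proof.
rewrite /exponent; case: B => [B| |] //= h; last first.
  apply: limf_einf_ge; near=> e.
  have e01 : 0 < e < 1 by near: e; exact: near_right.
  have -> : f e = 0 by near: e.
  by rewrite /lne normc0 lexx mulNyr ltr0_sg ?mulN1e // invr_lt0 ln_lt0.
apply/lee_subgt0Pr => eta eta0; apply: limf_einf_ge.
have C0 : 0 < normc b + 1 by have := normc_ge0 b; lra.
near=> e.
have [e01 le] : 0 < e < 1 /\ ln e < - (ln (normc b + 1) / eta).
  by near: e; exact: near_ln_lt.
rewrite -EFinB; apply: expo_ge e01 C0 eta0 le _.
by near: e; exact: power_limit_ub.
Unshelve. all: by end_near. Qed.

Lemma exponent_le f b B : power_limit f b B -> b != 0 -> (exponent f <= B%:E)%E.
Proof.
move=> h b0; rewrite /exponent.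
have nb2 : 0 < normc b / 2 by rewrite divr_gt0 // normc_gt0.
apply/lee_addgt0Pr => eta eta0; apply: limf_einf_le; near=> e.
have [e01 le] : 0 < e < 1 /\ ln e < ln (normc b / 2) / eta.
  by near: e; exact: near_ln_lt.
rewrite -EFinD; apply: expo_le e01 nb2 eta0 le _.
by near: e; exact: power_limit_lb.
Unshelve. all: by end_near. Qed.

End Powers.

(** * Vertices of the Newton polygon *)

Section Vertices.
Variables (R : realType) (n : nat).
Implicit Types (Pc : 'I_n.+1 -> R -> R[i]) (p : {poly R[i]}).
Implicit Types (P : 'I_n.+1 -> \bar R) (c : n.-tuple (\bar R)) (s t d : R).

(** The slope of [sum_min c] on the interval of radius [d] around [s], when this
    interval is free of entries of [c]: abscissa of a vertex of the Newton
    polygon. *)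
Definition vertex c s d : 'I_n.+1 := inord (n - count_below c (s - d)).

Lemma vertexE c s d : vertex c s d = (n - count_below c (s - d))%N :> nat.
Proof. by rewrite inordK // ltnS leq_subr. Qed.

(** On an interval free of roots the minimum of the affine functions
    [t |-> P k + k * t] is itself affine, so an index that attains it at the
    centre has its slope and attains it throughout.  A line of another integer
    slope that stays above the minimum at both ends of the interval is above it
    by at least [d] at the centre. *)
Lemma minplus_vertex P c s d : P ord_max = 0%E -> minplus_roots P c -> 0 < d ->
  gap c s d -> let k := vertex c s d in
  (forall t, `|t - s| <= d -> (P k + (k%:R * t)%:E = (sum_min c t)%:E)%E) /\
  (forall j : 'I_n.+1, j != k -> ((sum_min c s + d)%:E <= P j + (j%:R * s)%:E)%E).
Proof.
move=> P0 Pc d0 gc k; have [sc cN _] := Pc.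
have mE t : `|t - s| <= d -> sum_min c t = sum_min c s + k%:R * (t - s).
  by move=> ts; rewrite (sum_min_gap cN gc ts) vertexE.
have lb (j : 'I_n.+1) t : ((sum_min c t)%:E <= P j + (j%:R * t)%:E)%E.
  by rewrite -(minplus_rootsE P0 Pc); exact: minplus_fun_le.
have far (j : 'I_n.+1) : j != k -> ((sum_min c s + d)%:E <= P j + (j%:R * s)%:E)%E.
  move=> jk.
  have dd : `|s + d - s| <= d by rewrite addrC addKr gtr0_norm.
  have dm : `|s - d - s| <= d by rewrite addrC addKr normrN gtr0_norm.
  have := lb j (s + d); have := lb j (s - d); rewrite (mE _ dd) (mE _ dm).
  case: (P j) => [r| |] /=; [|by move=> _ _; rewrite leey|by rewrite leeNy_eq].
  rewrite -!EFinD !lee_fin => h1 h2.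
  have [lt|gt|eq] := ltngtP j k; last by rewrite (val_inj eq) eqxx in jk.
    have : (j%:R + 1 : R) <= k%:R by rewrite natr1 ler_nat.
    by nra.
  have : (k%:R + 1 : R) <= j%:R by rewrite natr1 ler_nat.
  by nra.
split => // t ts.
have [k' hk'] := minplus_fun_attained (minplus_rootsE P0 Pc s).
have k'k : k' = k.
  apply/eqP; apply: contraT => /far; rewrite hk' lee_fin leNgt ltrDl d0. by [].
move: hk'; rewrite k'k (mE _ ts); case: (P k) => [r| |] //=.
by rewrite -!EFinD => -[<-]; congr EFin; ring.
Qed.

(** The three cases, slope 0, slope [n] and an intermediate slope, correspond to
    the three non-vanishing conditions imposed on [p]. *)
Lemma vertex_neq0 Pc p P c s d : coef_asymp Pc p P c -> 0 < d -> gap c s d ->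
  p`_(vertex c s d) != 0.
Proof.
move=> [_ [pn P0] p0 Prc hp] d0 gc; have [sc cN _] := Prc.
have [hk _] := minplus_vertex P0 Prc d0 gc.
have := count_below_le c (s - d); rewrite leq_eqVlt => /orP[/eqP mn|mn].
  case: p0; first by rewrite vertexE mn subnn.
  have -> : ord0 = vertex c s d by apply/val_inj; rewrite /= vertexE mn subnn.
  by move=> Poo; have := hk s; rewrite subrr normr0 (ltW d0) Poo => /(_ isT).
have [m0|m0] := posnP (count_below c (s - d)); first by rewrite vertexE m0 subn0 pn oner_eq0.
rewrite vertexE; apply: hp; first by rewrite m0 /=; lia.
have lt1 : (nth +oo%E c (count_below c (s - d)).-1 <= (s - d)%:E)%E.
  by apply: nth_count_le => //; rewrite prednK.
apply: (le_lt_trans lt1).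
have := nth_count_gt (x := (s - d)%:E) +oo%E sc (i := count_below c (s - d)).
rewrite leqnn size_tuple mn => /(_ isT).
case: (gc (nth +oo%E c (count_below c (s - d)))); first by rewrite mem_nth // size_tuple.
  by move=> le; rewrite ltNge le.
by [].
Qed.

Lemma left_gap c s : exists2 d, 0 < d & gap c (s - d) d.
Proof.
have [d d0 h] := gap_exists (val c) s; exists d => // x /h[->|h'|h'].
- by right; rewrite subrK.
- by left; apply: (le_trans h'); rewrite lee_fin; lra.
- by right; apply: le_trans h'; rewrite lee_fin; lra.
Qed.

Lemma right_gap c s : exists2 d, 0 < d & gap c (s + d) d.
Proof.
have [d d0 h] := gap_exists (val c) s; exists d => // x /h[->|h'|h'].
- by left; rewrite addrK.
- by left; apply: (le_trans h'); rewrite lee_fin; lra.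
- by right; apply: le_trans h'; rewrite lee_fin; lra.
Qed.

Section Exponents.
Variables (Pc : 'I_n.+1 -> R -> R[i]) (p : {poly R[i]}) (P : 'I_n.+1 -> \bar R).
Variable c : n.-tuple (\bar R).
Hypothesis PcP : coef_asymp Pc p P c.

Let eP j := exponent (Pc j).

Lemma le_exponents j : (P j <= eP j)%E.
Proof. by have [[_ h] _ _ _ _] := PcP; exact: le_exponent (h j). Qed.

Lemma exponents_eq (j : 'I_n.+1) : p`_j != 0 -> eP j = P j.
Proof.
have [[_ /(_ j) h] _ _ _ _] := PcP => pj; apply/le_anti; rewrite le_exponents andbT.
move: h; rewrite /eP; case: (P j) => [B| |] //= h; last by rewrite leey.
exact: exponent_le h pj.
Qed.

Let P0 : P ord_max = 0%E. Proof. by have [_ []] := PcP. Qed.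
Let Prc : minplus_roots P c. Proof. by have [] := PcP. Qed.
Let pn : p`_n != 0. Proof. by have [_ [-> _] _ _ _] := PcP; exact: oner_neq0. Qed.

Lemma exponents_max : eP ord_max = 0%E.
Proof. by rewrite exponents_eq. Qed.

(** The exponents dominate [P], and coincide with it at the vertices, which are
    enough to attain the minimum at every point. *)
Lemma exponents_roots : minplus_roots eP c.
Proof.
have [sc cN _] := Prc.
apply: minplus_roots_sum_min => //; first exact: exponents_max.
move=> y; apply: minplus_funP => [k|].
  rewrite -(minplus_rootsE P0 Prc); apply: (le_trans (minplus_fun_le P y k)).
  by rewrite leeD2r // le_exponents.
have [d d0 gc] := right_gap c y; exists (vertex c (y + d) d).
have [hk _] := minplus_vertex P0 Prc d0 gc.
rewrite exponents_eq ?hk //; last exact: vertex_neq0 PcP d0 gc.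
by rewrite opprD addNKr normrN gtr0_norm.
Qed.

(** Convexity is given for the epigraph as a subset of the plane; the points
    combined here lie on a line of slope [- a]. *)
Lemma epigraph_segment (g : R -> \bar R) (u v x a z : R) :
  convex_set (epigraph g) -> u < v -> u <= x <= v ->
  (g u <= (z - u * a)%:E)%E -> (g v <= (z - v * a)%:E)%E ->
  (g x <= (z - x * a)%:E)%E.
Proof.
move=> cg uv /andP[ux xv] gu gv.
pose l := (v - x) / (v - u).
have vu0 : 0 < v - u by rewrite subr_gt0.
have l0 : 0 <= l by rewrite divr_ge0 ?subr_ge0 //= ?(ltW uv).
have l1 : l <= 1 by rewrite ler_pdivrMr // mul1r lerD2l lerN2.
have := cg (u, z - u * a) (v, z - v * a) (Itv01 l0 l1).
rewrite !inE => /(_ gu gv).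
have xE : l * u + (1 - l) * v = x by rewrite /l; field; rewrite gt_eqF.
suff -> : conv (Itv01 l0 l1) ((u, z - u * a) : convex_lmodType (R^o * R^o)%type)
    ((v, z - v * a) : convex_lmodType (R^o * R^o)%type) = (x, z - x * a) by [].
rewrite -xE; congr pair.
by rewrite /=/unstable.onem /GRing.scale /=; ring.
Qed.

(** At [N + d], the line [r + k * t] cannot exceed by [d] a line of larger slope
    [k'] starting from [x] at [N], once [d] is larger than their gap at [N]. *)
Let slopes_contra (x y r k k' N d : R) : 0 < d -> r + k * N - x <= d - 1 ->
  k + 1 <= k' -> x = y + k' * - d -> y + d <= r + k * (N + d) -> False.
Proof.
move=> d0 hd hk hx hy.
by have : 0 <= (k' - (k + 1)) * d; [rewrite mulr_ge0 ?subr_ge0 // ltW|lra].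
Qed.

Lemma coef_funP (Q : 'I_n.+1 -> \bar R) (k : 'I_n.+1) : coef_fun Q k%:R = Q k.
Proof.
rewrite /coef_fun (eq_bigl (pred1 k)); last first.
  by move=> j; rewrite /= eqr_nat eq_sym.
by rewrite big_pred1_eq.
Qed.

Lemma le_coef_fun (Q : 'I_n.+1 -> \bar R) (g : R -> \bar R) :
  (forall z, (g z <= coef_fun Q z)%E) <-> (forall k : 'I_n.+1, (g k%:R <= Q k)%E).
Proof.
split=> h z; first by have := h z%:R; rewrite coef_funP.
by apply: le_bigmin => [|k /eqP ->]; rewrite ?leey.
Qed.

(** At an index [k < n] with finite [P k], let [s] be the root numbered [n - k].  The
    vertices immediately to the left and to the right of [s] are at abscissas on
    either side of [k], both active at [s], and the exponents agree with [P]
    there.  A convex minorant of the exponents is thus bounded at [k] by the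
    segment joining them, which lies below [P]. *)
Lemma convex_minorants (g : R -> \bar R) : convex_set (epigraph g) ->
  (forall z, (g z <= coef_fun eP z)%E) <-> (forall z, (g z <= coef_fun P z)%E).
Proof.
move=> cg; rewrite !le_coef_fun; split=> [h k|h k]; last first.
  exact: le_trans (h k) (le_exponents k).
have [sc cN _] := Prc.
have hv s d : 0 < d -> gap c s d -> forall t, `|t - s| <= d ->
    (g (vertex c s d)%:R <= (sum_min c t - (vertex c s d)%:R * t)%:E)%E.
  move=> d0 gc t ts; apply: (le_trans (h _)).
  rewrite exponents_eq; last exact: vertex_neq0 PcP d0 gc.
  have [/(_ t ts) hk _] := minplus_vertex P0 Prc d0 gc.
  by move: hk; case: (P _) => [r| |] //=; rewrite -EFinD => -[<-]; rewrite addrK.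
case E : (P k) => [r| |]; last 2 first.
- by rewrite leey.
- by have [[_ hP] _ _ _ _] := PcP; have := hP k; rewrite E.
have lb t : sum_min c t <= r + k%:R * t.
  rewrite -lee_fin -(minplus_rootsE P0 Prc) EFinD -E; exact: minplus_fun_le.
have [kn|nk] := ltnP k n; last first.
  have kE : k = ord_max by apply/val_inj/anti_leq; rewrite -ltnS ltn_ord.
  by apply: (le_trans (h k)); rewrite kE exponents_max -P0 -kE E.
pose i := (n - k.+1)%N.
have lin : (i < n)%N by rewrite /i; lia.
case Ec : (nth +oo%E c i) => [s| |]; last 2 first.
- exfalso.
  (* With an infinite root at this place, all finite roots are below some N,
     so the interval ]N, N + 2 d[ is free of roots for every d. *)
  have [N NP] : exists N : R, forall x, x \in val c -> x = +oo%E \/ (x <= N%:E)%E.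
    elim: (val c) => [|x l [N NP]]; first by exists 0.
    exists (Num.max N (fine x)) => y; rewrite inE => /orP[/eqP ->|/NP[->|le]].
    - case: x => [a| |]; [right|by left|by right; rewrite leNye].
      by rewrite lee_fin le_max lexx orbT.
    - by left.
    - by right; apply: (le_trans le); rewrite lee_fin le_max lexx.
  have [d d0 hd] : exists2 d : R, 0 < d & r + k%:R * N - sum_min c N <= d - 1.
    exists (`|r + k%:R * N - sum_min c N| + 1); first by rewrite ltr_wpDl.
    by rewrite addrK ler_norm.
  have gc : gap c (N + d) d.
    by move=> x /NP[->|le]; [right; rewrite leey|left; rewrite addrK].
  have lt : (k < vertex c (N + d) d)%N.
    rewrite vertexE addrK; suff : (count_below c N <= i)%N by rewrite /i; lia.
    rewrite leqNgt; apply/negP => /(nth_count_le +oo%E sc).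
    by rewrite Ec leye_eq.
  have [_ /(_ k)] := minplus_vertex P0 Prc d0 gc.
  rewrite -(inj_eq val_inj) /= ltn_eqF // => /(_ isT).
  have := sum_min_gap cN gc (t := N); rewrite opprD addNKr normrN gtr0_norm //.
  rewrite -vertexE E -EFinD lee_fin => /(_ (lexx _)) mE.
  apply: (slopes_contra (k' := (vertex c (N + d) d)%:R) d0 hd _ mE).
  by rewrite natr1 ler_nat.
- by move: cN; rewrite -Ec mem_nth // size_tuple.
have [d1 d10 gc1] := left_gap c s; have [d2 d20 gc2] := right_gap c s.
set k1 := vertex c (s - d1) d1; set k2 := vertex c (s + d2) d2.
have kk1 : (k < k1)%N.
  rewrite /k1 vertexE; set m := count_below c _; suff : (m <= i)%N by rewrite /i; lia.
  rewrite leqNgt; apply/negP => /(nth_count_le +oo%E sc).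
  by rewrite Ec lee_fin; lra.
have k2k : (k2 <= k)%N.
  rewrite /k2 vertexE addrK; set m := count_below c _; suff : (i < m)%N by rewrite /i; lia.
  rewrite ltnNge; apply/negP => le.
  have := nth_count_gt (x := s%:E) +oo%E sc (i := i).
  by rewrite size_tuple lin andbT => /(_ le); rewrite Ec ltxx.
apply: (@le_trans _ _ (sum_min c s - k%:R * s)%:E); last first.
  by rewrite lee_fin lerBlDr lb.
apply: (@epigraph_segment g k2%:R k1%:R) => //.
- by rewrite ltr_nat; apply: leq_ltn_trans kk1.
- by rewrite !ler_nat k2k ltnW.
- by apply: hv => //; rewrite opprD addNKr normrN gtr0_norm.
- by apply: hv => //; rewrite opprB addrC subrK gtr0_norm.
Qed.

(** Convex hulls are suprema of convex minorants, and these are the same for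
    both sides. *)
Lemma exponents_bar j : minplus_bar eP j = minplus_bar P j.
Proof.
rewrite /minplus_bar /vex.
suff -> : [set g : R -> \bar R | convex_set (epigraph g) /\
    forall z, (g z <= coef_fun eP z)%E] =
  [set g | convex_set (epigraph g) /\ forall z, (g z <= coef_fun P z)%E] by [].
by apply/seteqP; split=> g [cg /(convex_minorants cg) hg].
Qed.

End Exponents.
End Vertices.

(** * The polynomial at a fixed scale *)

Section PolyLimits.
Variable R : realType.
Variables (T : Type) (F : set_system T).
Context {FF : Filter F}.
Implicit Types (A B : T -> {poly R[i]}) (a b : {poly R[i]}).

Definition tends_coef A a := forall k, tends F (fun x => (A x)`_k) a`_k.

Lemma tends_coefM A B a b : tends_coef A a -> tends_coef B b ->
  tends_coef (fun x => A x * B x) (a * b).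
Proof.
move=> Aa Bb k; rewrite coefM.
apply: (tends_eq (f := fun x => \sum_(j < k.+1) (A x)`_j * (B x)`_(k - j))).
  by move=> x; rewrite coefM.
by apply: tends_sum => j _; exact: tendsM.
Qed.

Lemma tends_coef_prod (I : Type) (r : seq I) (A : I -> T -> {poly R[i]})
    (a : I -> {poly R[i]}) :
  (forall i, tends_coef (A i) (a i)) ->
  tends_coef (fun x => \prod_(i <- r) A i x) (\prod_(i <- r) a i).
Proof.
move=> h; elim: r => [|i r IH] k.
  by rewrite big_nil; apply: tends_eq (tends_cst _) => x; rewrite big_nil.
rewrite big_cons; apply: tends_eq (tends_coefM (h i) IH k) => x.
by rewrite big_cons.
Qed.

End PolyLimits.

Lemma coef_comp_scaleX (K : comNzRingType) (q : {poly K}) (a : K) k :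
  (q \Po (a *: 'X))`_k = a ^+ k * q`_k.
Proof.
rewrite comp_polyE coef_sum.
rewrite (eq_bigr (fun i : 'I_(size q) => if (i : nat) == k then a ^+ k * q`_k else 0)).
  case: (ltnP k (size q)) => [lt|le].
    rewrite (bigD1 (Ordinal lt)) //= eqxx big1 ?addr0 // => i.
    by rewrite -val_eqE /= => /negbTE ->.
  rewrite big1 ?nth_default ?mulr0 // => i _.
  by rewrite ltn_eqF // (leq_trans (ltn_ord i) le).
move=> i _; rewrite coefZ exprZn coefZ coefXn eq_sym.
by case: eqP => [->|_]; [rewrite mulr1 mulrC|rewrite !mulr0].
Qed.

Section RootLists.
Variable F : fieldType.
Implicit Types (q : {poly F}) (s : seq F).

Lemma root_list_prod s : root_list (\prod_(z <- s) ('X - z%:P)) s.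
Proof.
split=> [|z]; last by rewrite mu_prod_XsubC.
by rewrite -size_poly_eq0 size_prod_XsubC.
Qed.

Lemma mup_prod (I : Type) (r : seq I) (f : I -> {poly F}) z :
  (forall i, f i != 0) ->
  mup z (\prod_(i <- r) f i) = (\sum_(i <- r) mup z (f i))%N.
Proof.
move=> f0; elim: r => [|i r IH].
  by rewrite !big_nil; apply: mupNroot; rewrite rootE hornerE oner_eq0.
rewrite !big_cons mupM ?IH //.
by elim/big_rec: _ => [|j x _ x0]; rewrite ?oner_eq0 // mulf_neq0.
Qed.

End RootLists.

Lemma root_listP (F : closedFieldType) (q : {poly F}) (s : seq F) :
  q \is monic -> root_list q s -> q = \prod_(z <- s) ('X - z%:P).
Proof.
move=> /monicP lead [_ qs]; have [r rE] := closed_field_poly_normal q.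
move: rE; rewrite lead scale1r => rE; rewrite rE; apply: perm_big.
by apply/allP => z _ /=; rewrite qs -mu_prod_XsubC -rE.
Qed.

Lemma tends_powR (R : realType) (d : R) : 0 < d ->
  tends 0^'+ (fun e : R => (e `^ d)%:C) 0.
Proof.
move=> d0 eta eta0; have := near_powR_small d0 eta0; apply: filterS => e h.
by rewrite sub0r normcN normc_real ger0_norm ?powR_ge0.
Qed.

Section Scaling.
Variable R : realType.
Implicit Types (f : R -> R[i]) (b z : R[i]) (B x : \bar R) (s t : R).

Lemma powRD_gt0 (e s t : R) : 0 < e -> e `^ (s + t) = e `^ s * e `^ t.
Proof. by move=> e0; rewrite powRD // (gt_eqF e0) implybT. Qed.

Lemma near_powRD (s t : R) : \forall e \near 0^'+, e `^ (s + t) = e `^ s * e `^ t.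
Proof.
near=> e; have e0 : 0 < e by near: e; exact: nbhs_right_gt.
exact: powRD_gt0.
Unshelve. all: by end_near. Qed.

(** Multiplying by a larger power than the exact one forces the limit 0. *)
Lemma tends_rescale f b (B : R) t : power_limit f b B -> - B <= t ->
  tends 0^'+ (fun e => (e `^ t)%:C * f e) (if t == - B then b else 0).
Proof.
move=> /power_limitP fb Bt; case: eqVneq => [->//|tB].
have d0 : 0 < t + B.
  by have : - B < t; [rewrite lt_neqAle eq_sym tB | lra].
rewrite -(mul0r b); apply: tends_near (tendsM (tends_powR d0) fb).
apply: filterS (nbhs_right_gt 0) => e e0.
have -> : e `^ t = e `^ (t + B) * e `^ (- B).
  by rewrite -powRD_gt0 ?addrK.
by rewrite rmorphM mulrA.
Qed.

(** The limit of the factor of a root [f] with [f(e) ~ z e^x], seen at scale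
    [e^s] and normalized by the larger of the two scales. *)
Definition scaled_factor s z x : {poly R[i]} :=
  if (x < s%:E)%E then (- z)%:P else if x == s%:E then 'X - z%:P else 'X.

Lemma tends_factor f b B s : asymp f b B ->
  tends_coef 0^'+ (fun e => (e `^ (- rmin s B))%:C *: ((e `^ s)%:C *: 'X - (f e)%:P))
    (scaled_factor s b B).
Proof.
move=> fb k.
have cE e : ((e `^ (- rmin s B))%:C *: ((e `^ s)%:C *: 'X - (f e)%:P))`_k =
    (e `^ (- rmin s B))%:C * (e `^ s)%:C * (k == 1)%:R -
    ((e `^ (- rmin s B))%:C * f e) * (k == 0)%:R.
  rewrite coefZ coefB coefZ coefX coefC mulrBr mulrA; congr (_ - _).
  by case: k => [|k]; rewrite ?mulr1 ?mulr0.
have h1 : tends 0^'+ (fun e => (e `^ (- rmin s B))%:C * (e `^ s)%:C)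
    (if (B < s%:E)%E then 0 else 1).
  have sE := near_powRD (- rmin s B) s.
  case: ifPn => [|]; last first.
    rewrite -leNgt => le; apply: tends_near (tends_cst 1); apply: filterS sE => e.
    by rewrite rmin_ge // -rmorphM => <-; rewrite addNr powRr0.
  case: B fb sE {cE} => [r| |] //= _ sE; rewrite lte_fin => rs.
  rewrite rmin_le ?(ltW rs) // in sE *.
  apply: tends_near (tends_powR (d := - r + s) _); last by lra.
  by apply: filterS sE => e ->; rewrite rmorphM.
have h2 : tends 0^'+ (fun e => (e `^ (- rmin s B))%:C * f e)
    (if (B <= s%:E)%E then b else 0).
  case: B fb {cE h1} => [r| |] //=; last first.
    move=> f0; apply: tends_near (tends_cst 0); apply: filterS f0 => e ->.
    by rewrite mulr0.
  move=> [_ fb]; rewrite lee_fin; have [rs|sr] := leP r s.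
    by rewrite rmin_le //; exact/power_limitP.
  rewrite rmin_ge; last by rewrite lee_fin ltW.
  have := tends_rescale (t := - s) fb; rewrite eqr_opp lt_eqF //; apply; lra.
apply: (tends_eq (fun e => esym (cE e))).
have -> : (scaled_factor s b B)`_k = (if (B < s%:E)%E then 0 else 1) * (k == 1)%:R -
    (if (B <= s%:E)%E then b else 0) * (k == 0)%:R.
  rewrite /scaled_factor; case: (ltgtP B s%:E) => _;
  rewrite ?coefN ?coefB ?coefX ?coefC; case: k {cE} => [|k] /=;
  by rewrite ?mulr0 ?mulr1 ?mul0r ?mul1r ?sub0r ?subr0 ?oppr0.
apply: tendsD; first by apply: tendsM h1 (tends_cst _).
by apply: tendsN; apply: tendsM h2 (tends_cst _).
Qed.

End Scaling.

Lemma prod_powR (R : realType) (I : Type) (r : seq I) (u : I -> R) (e : R) : 0 < e ->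
  \prod_(i <- r) e `^ u i = e `^ (\sum_(i <- r) u i).
Proof.
move=> e0; elim: r => [|i r IH]; first by rewrite !big_nil powRr0.
by rewrite !big_cons IH powRD_gt0.
Qed.

Section PolyAt.
Variables (R : realType) (n : nat) (Pc : 'I_n.+1 -> R -> R[i]).

Lemma coef_poly_at e (k : 'I_n.+1) : (poly_at Pc e)`_k = Pc k e.
Proof.
rewrite /poly_at coef_sum (bigD1 k) //= coefZ coefXn eqxx mulr1 big1 ?addr0 // => i.
by rewrite coefZ coefXn eq_sym -val_eqE => /negbTE ->; rewrite mulr0.
Qed.

Lemma coef_poly_at_gt e k : (n < k)%N -> (poly_at Pc e)`_k = 0.
Proof.
move=> nk; rewrite /poly_at coef_sum big1 // => i _.
by rewrite coefZ coefXn gtn_eqF ?mulr0 // (leq_trans (ltn_ord i)).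
Qed.

Lemma size_poly_at e : (size (poly_at Pc e) <= n.+1)%N.
Proof. by apply/leq_sizeP => k; exact: coef_poly_at_gt. Qed.

Lemma monic_poly_at e : Pc ord_max e = 1 ->
  size (poly_at Pc e) = n.+1 /\ poly_at Pc e \is monic.
Proof.
move=> P1; have cn : (poly_at Pc e)`_n = 1 by rewrite (coef_poly_at e ord_max).
have sz : size (poly_at Pc e) = n.+1.
  apply/eqP; rewrite eqn_leq size_poly_at /=; apply: contraT; rewrite -leqNgt => le.
  by move: cn; rewrite nth_default // => /esym/eqP; rewrite oner_eq0.
by split=> //; apply/monicP; rewrite lead_coefE sz.
Qed.

End PolyAt.

Section SaturatedPart.
Variables (R : realType) (n : nat) (Pc : 'I_n.+1 -> R -> R[i]).
Variables (p : {poly R[i]}) (P : 'I_n.+1 -> \bar R).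

Lemma coef_saturated_part s (k : 'I_n.+1) : (saturated_part p P s)`_k =
  if minplus_fun P s == (P k + (k%:R * s)%:E)%E then p`_k else 0.
Proof.
rewrite /saturated_part coef_sum big_mkcond (bigD1 k) //= coefZ coefXn eqxx mulr1.
rewrite big1 ?addr0 // => i; rewrite -val_eqE /= coefZ coefXn eq_sym => /negbTE ->.
by rewrite mulr0 if_same.
Qed.

Lemma size_saturated_part s : (size (saturated_part p P s) <= n.+1)%N.
Proof.
apply/leq_sizeP => k nk; rewrite /saturated_part coef_sum big1 // => i _.
by rewrite coefZ coefXn gtn_eqF ?mulr0 // (leq_trans (ltn_ord i)).
Qed.

(** By definition of the minimum, the scaling exponent is at least that of the
    coefficient, with equality exactly at the saturated indices. *)
Lemma tends_saturated_coef s (m : R) (k : 'I_n.+1) :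
  (forall j, weak_asymp (Pc j) p`_j (P j)) -> minplus_fun P s = m%:E ->
  tends 0^'+ (fun e => (e `^ (k%:R * s - m))%:C * Pc k e) (saturated_part p P s)`_k.
Proof.
move=> hP hs; rewrite coef_saturated_part.
have := minplus_fun_le P s k; rewrite hs; have := hP k.
case: (P k) => [B| |] //= hk; last first.
  move=> _; apply: tends_near (tends_cst 0); apply: filterS hk => e ->.
  by rewrite mulr0.
rewrite -EFinD lee_fin eqe => le.
have := tends_rescale (t := k%:R * s - m) hk.
have -> : (k%:R * s - m == - B) = (m == B + k%:R * s).
  by apply/eqP/eqP => h; lra.
by apply; lra.
Qed.

End SaturatedPart.

Section FromRoots.
Variables (R : realType) (n : nat) (Pc : 'I_n.+1 -> R -> R[i]).
Hypothesis Pc_monic : \forall e \near 0^'+, Pc ord_max e = 1.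
Variables (Yf : 'I_n -> R -> R[i]) (y : n.-tuple R[i]) (Y : n.-tuple (\bar R)).
Hypothesis YfP : root_asymp Pc Yf y Y.

Lemma root_exponents_Ny : -oo%E \notin Y.
Proof.
have [_ _ hY _] := YfP; apply/negP => /tnthP[j Ej].
by have := hY j; rewrite -Ej.
Qed.

Lemma near_factored :
  \forall e \near 0^'+, poly_at Pc e = \prod_(j < n) ('X - (Yf j e)%:P).
Proof.
have [_ hr _ _] := YfP; apply: filterS2 hr Pc_monic => e hr P1.
have [_ mon] := monic_poly_at P1.
rewrite (root_listP mon hr) big_map big_enum //.
Qed.

(** The limit of the whole polynomial at scale [e^s]. *)
Definition limit_poly s : {poly R[i]} :=
  \prod_(j < n) scaled_factor s (tnth y j) (tnth Y j).

(** Substituting [e^s 'X] in the factored polynomial and multiplying by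
    [e^(- sum_min Y s)] distributes over the factors, each of which converges. *)
Lemma tends_scaled_coef s (k : 'I_n.+1) :
  tends 0^'+ (fun e => (e `^ (k%:R * s - sum_min Y s))%:C * Pc k e) (limit_poly s)`_k.
Proof.
have [_ _ hY _] := YfP.
have := tends_coef_prod (F := 0^'+) (index_enum 'I_n)
  (A := fun j e => (e `^ (- rmin s (tnth Y j)))%:C *: ((e `^ s)%:C *: 'X - (Yf j e)%:P))
  (a := fun j => scaled_factor s (tnth y j) (tnth Y j)).
move=> /(_ _ (fun j => tends_factor s (hY j)) k); apply: tends_near.
apply: filterS2 (nbhs_right_gt 0) near_factored => e e0 fE.
rewrite scaler_prod coefZ.
have -> : \prod_(j < n) ((e `^ s)%:C *: 'X - (Yf j e)%:P) =
    poly_at Pc e \Po ((e `^ s)%:C *: 'X).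
  rewrite fE rmorph_prod; apply: eq_bigr => j _ /=.
  by rewrite comp_polyB comp_polyX comp_polyC.
rewrite coef_comp_scaleX coef_poly_at mulrA; congr (_ * _).
rewrite -rmorph_prod /= prod_powR // sumrN -/(sum_min Y s) -rmorphXn -rmorphM /=.
by rewrite -powR_mulrn ?powR_ge0 // -powRrM -powRD_gt0 // addrC (mulrC s).
Qed.

Lemma scaled_factor_neq0 s j : scaled_factor s (tnth y j) (tnth Y j) != 0.
Proof.
have [_ _ hY _] := YfP; have := hY j; rewrite /scaled_factor.
case: ifPn => [lt|_ _].
  case: (tnth Y j) lt => [r| |] // _ [y0 _].
  by rewrite polyC_eq0 oppr_eq0.
by case: ifP => _; rewrite ?polyXsubC_eq0 ?polyX_eq0.
Qed.

Lemma limit_poly_neq0 s : limit_poly s != 0.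
Proof. by apply/prodf_neq0 => j _; exact: scaled_factor_neq0. Qed.

Lemma mup_limit_poly s z : z != 0 -> mup z (limit_poly s) =
  (\sum_(j < n) ((tnth Y j == s%:E) && (tnth y j == z)))%N.
Proof.
move=> z0; rewrite /limit_poly mup_prod; last exact: scaled_factor_neq0.
apply: eq_bigr => j _; have [_ _ hY _] := YfP; have := hY j.
have mX : mup z ('X : {poly R[i]}) = 0%N.
  by apply: mupNroot; rewrite rootX.
rewrite /scaled_factor; case: ltgtP => [lt|//|->] => [|_] /=.
  case: (tnth Y j) lt => [r| |] // _ [y0 _]; apply: mupNroot.
  by rewrite rootC oppr_eq0.
by rewrite -['X - _]expr1 mup_XsubCX; case: eqP.
Qed.

Lemma limit_poly_unique s (q : {poly R[i]}) : (size q <= n.+1)%N ->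
  (forall k : 'I_n.+1,
    tends 0^'+ (fun e => (e `^ (k%:R * s - sum_min Y s))%:C * Pc k e) q`_k) ->
  q = limit_poly s.
Proof.
move=> sq qP; apply/polyP => k; have [kn|nk] := ltnP k n.+1.
  exact: tends_unique (qP (Ordinal kn)) (tends_scaled_coef s (Ordinal kn)).
rewrite !nth_default ?(leq_trans sq) //.
apply: leq_trans nk; apply: (leq_trans (size_prod_leq _ _)).
rewrite card_ord leq_subLR.
apply: (@leq_trans (\sum_(j < n) 2).+1); last by rewrite sum_nat_const card_ord; lia.
rewrite ltnS; apply: leq_sum => j _; rewrite /scaled_factor.
case: ifP => _; first by rewrite (leq_trans (size_polyC_leq1 _)).
by case: ifP => _; rewrite ?size_XsubC ?size_polyX.
Qed.

(** Both sides are limits of the same scaled polynomial. *)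
Lemma saturated_limit_poly (p : {poly R[i]}) (P : 'I_n.+1 -> \bar R) s :
  (forall j, weak_asymp (Pc j) p`_j (P j)) -> minplus_fun P s = (sum_min Y s)%:E ->
  saturated_part p P s = limit_poly s.
Proof.
move=> hP hs; apply: limit_poly_unique (size_saturated_part p P s) _ => k.
exact: tends_saturated_coef.
Qed.

(** The hypotheses place the [k] entries of [Y] equal to [s] at the indices
    [i, ..., i + k - 1], and only the corresponding factors of [limit_poly s] have
    a non-zero root. *)
Lemma limit_poly_nonzero_roots s i k : (0 < k)%N -> count_mem s%:E Y = k ->
  (forall j, (i <= j < i + k)%N -> nth +oo%E Y j = s%:E) ->
  nonzero_root_list (limit_poly s) [seq nth 0 y j | j <- iota i k].
Proof.
move=> k0 ck hY; have [_ _ hy _] := YfP.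
have lt_n j : (i <= j < i + k)%N -> (j < n)%N.
  move=> /hY Yj; rewrite ltnNge; apply/negP => nj; move: Yj.
  by rewrite nth_default // size_tuple.
have ikn : (i + k <= n)%N.
  by have := lt_n (i + k).-1; lia.
split; first exact: limit_poly_neq0.
  apply/mapP => -[j]; rewrite mem_iota => ij; have jn := lt_n j ij.
  have := hy (Ordinal jn); rewrite (tnth_nth 0 y) (tnth_nth +oo%E Y) /= (hY j ij).
  by move=> [y0 _] yE; rewrite -yE eqxx in y0.
move=> z z0; rewrite mup_limit_poly // count_map.
pose a j := nth +oo%E Y j == s%:E; pose b j := nth 0 y j == z.
have -> : (\sum_(j < n) ((tnth Y j == s%:E) && (tnth y j == z)) =
    count (predI a b) (iota 0 n))%N.
  have <- : index_iota 0 n = iota 0 n by rewrite /index_iota subn0.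
  rewrite -sum1_count [RHS]big_mkcond big_mkord.
  apply: eq_bigr => j _; rewrite (tnth_nth +oo%E Y) (tnth_nth 0 y) /= -/(a j) -/(b j).
  by case: (a j); case: (b j).
have split_n (q : pred nat) : count q (iota 0 n) =
    (count q (iota 0 i) + (count q (iota i k) + count q (iota (i + k) (n - (i + k)))))%N.
  by rewrite -!count_cat -!iotaD; congr (count _ (iota _ _)); lia.
have ai : count a (iota i k) = k.
  rewrite -[RHS](size_iota i k); apply/eqP; rewrite -all_count; apply/allP => j.
  by rewrite mem_iota /a => /hY ->.
have an : count a (iota 0 n) = k.
  rewrite -ck -[in RHS](mkseq_nth +oo%E Y) count_map size_tuple; exact: eq_count.
have ab (t : seq nat) : (count (predI a b) t <= count a t)%N.
  by apply: sub_count => j /andP[].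
rewrite split_n; have := split_n a; rewrite an ai => hk.
have z1 : count a (iota 0 i) = 0%N by lia.
have z2 : count a (iota (i + k) (n - (i + k))) = 0%N by lia.
have abz t : count a t = 0%N -> count (predI a b) t = 0%N.
  by move=> at0; apply/eqP; rewrite -leqn0 -at0 ab.
rewrite (abz _ z1) (abz _ z2) add0n addn0.
have -> : count (predI a b) (iota i k) = count b (iota i k).
  apply: eq_in_count => j; rewrite mem_iota /= => /hY Yj.
  by rewrite /a Yj eqxx.
by [].
Qed.

Lemma sum_minE t :
  (sum_min Y t)%:E = (\sum_(j < n) mine t%:E (tnth Y j))%E.
Proof.
rewrite /sum_min -sumEFin; apply: eq_bigr => j _.
by rewrite rmin_EFin //; apply: contraNneq root_exponents_Ny => <-; exact: mem_tnth.
Qed.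

End FromRoots.

(** * From roots to coefficients *)

(** Only the factors before [m] matter, up to a shift by the power of ['X]. *)
Lemma coef_prod_tailX (K : comNzRingType) n m (f : 'I_n -> {poly K}) k :
  (m <= n)%N -> (forall j : 'I_n, (m <= j)%N -> f j = 'X) ->
  (\prod_(j < n) f j)`_k =
    if (k < n - m)%N then 0 else (\prod_(j < n | (j < m)%N) f j)`_(k - (n - m)).
Proof.
move=> mn fX; rewrite (bigID (fun j : 'I_n => (j < m)%N)) /=.
rewrite [X in _ * X](eq_bigr (fun=> 'X)) => [|j]; last by rewrite -leqNgt => /fX.
rewrite [X in _ * X](eq_bigl (fun j : 'I_n => true && (m <= j)%N)) => [|j]; last by rewrite -leqNgt.
by rewrite -(big_geq_mkord m n predT (fun=> 'X)) prodr_const_nat coefMXn.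
Qed.

Section RootsToCoefs.
Variables (R : realType) (n : nat) (Pc : 'I_n.+1 -> R -> R[i]).
Hypothesis Pc_monic : \forall e \near 0^'+, Pc ord_max e = 1.
Variables (Yf : 'I_n -> R -> R[i]) (y : n.-tuple R[i]) (Y : n.-tuple (\bar R)).
Hypothesis YfP : root_asymp Pc Yf y Y.

Let sY : sorted <=%O Y. Proof. by have [] := YfP. Qed.
Let YN (j : 'I_n) : tnth Y j != -oo%E.
Proof.
by apply: contraNneq (root_exponents_Ny YfP) => <-; exact: mem_tnth.
Qed.

Let Yle (i j : 'I_n) : (i <= j)%N -> (tnth Y i <= tnth Y j)%E.
Proof.
move=> ij; rewrite !(tnth_nth +oo%E).
by apply: (sorted_leq_nth le_trans le_refl _ sY); rewrite ?inE ?size_tuple.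
Qed.

(** The valuation expected of the elementary symmetric function of degree [n - k]
    of the roots, that is of the coefficient of index [k]. *)
Definition prefix_sum (k : 'I_n.+1) : \bar R :=
  (\sum_(j < n | (j < n - k)%N) tnth Y j)%E.

(** In this form the terms are compared one by one with those of [sum_min]:
    each is at least the minimum of [t] and the entry of [Y]. *)
Lemma prefix_sumD t (k : 'I_n.+1) : (prefix_sum k + (k%:R * t)%:E =
  \sum_(j < n) if (j < n - k)%N then tnth Y j else t%:E)%E.
Proof.
rewrite big_if /=; congr (_ + _)%E.
rewrite sumEFin (eq_bigl (fun j : 'I_n => true && (n - k <= j)%N)); last first.
  by move=> j; rewrite -leqNgt.
rewrite -(big_geq_mkord (n - k) n predT (fun=> t)) sumr_const_nat subKn ?mulr_natl //.
by rewrite -ltnS.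
Qed.

Lemma prefix_minplus t : minplus_fun prefix_sum t = (sum_min Y t)%:E.
Proof.
apply: minplus_funP => [k|].
  rewrite prefix_sumD (sum_minE YfP); apply: lee_sum => j _.
  by case: ifP => _; rewrite ge_min lexx ?orbT.
exists (inord (n - count_below Y t)); rewrite prefix_sumD (sum_minE YfP); apply: lee_sum => j _.
rewrite inordK ?ltnS ?leq_subr // subKn ?count_below_le // le_min (tnth_nth +oo%E).
case: ifP => jc; first by rewrite nth_count_le // lexx.
rewrite lexx /= ltW // nth_count_gt //.
by rewrite leqNgt jc size_tuple ltn_ord.
Qed.

Lemma prefix_roots : minplus_roots prefix_sum Y.
Proof.
apply: minplus_roots_sum_min sY (root_exponents_Ny YfP) prefix_minplus.
by rewrite /prefix_sum big_pred0 // => j; rewrite /= subnn.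
Qed.

(** The scale at which the coefficient of index [k] is read off is the last
    exponent entering [prefix_sum k].  When that exponent is infinite, [fine] turns
    it into 0 and the coefficient vanishes near 0. *)
Definition root_coef k : R[i] :=
  if k == n then 1 else (limit_poly y Y (fine (nth +oo%E Y (n - k).-1)))`_k.

Lemma prefix_sum_fin (k : 'I_n.+1) (i : 'I_n) s : i.+1 = (n - k)%N ->
  tnth Y i = s%:E -> prefix_sum k = (sum_min Y s - k%:R * s)%:E.
Proof.
move=> ik Yi.
have : (prefix_sum k + (k%:R * s)%:E = (sum_min Y s)%:E)%E.
  rewrite prefix_sumD (sum_minE YfP); apply: eq_bigr => j _; rewrite -Yi -ik ltnS.
  case: ifP => ji; first by rewrite min_r ?Yle.
  by rewrite min_l ?Yle // ltnW // ltnNge ji.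
by case: (prefix_sum k) => [r| |] //; rewrite -EFinD => -[<-]; rewrite addrK.
Qed.

Lemma root_coef_asymp k : weak_asymp (Pc k) (root_coef k) (prefix_sum k).
Proof.
have [kn|kn] := eqVneq (k : nat) n.
  have -> : prefix_sum k = 0%E by rewrite /prefix_sum big_pred0 // => j; rewrite kn subnn.
  rewrite /root_coef kn eqxx /=; apply/power_limitP.
  have kmax : k = ord_max by apply: val_inj.
  apply: tends_near (tends_cst 1); apply: filterS Pc_monic => e.
  by rewrite kmax oppr0 powRr0 mul1r => ->.
have lin : ((n - k).-1 < n)%N by have := ltn_ord k; lia.
pose i := Ordinal lin.
have ik : i.+1 = (n - k)%N by rewrite /=; have := ltn_ord k; lia.
have Yi : tnth Y i = nth +oo%E Y (n - k).-1 by rewrite (tnth_nth +oo%E).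
rewrite /root_coef (negbTE kn) -Yi; have := YN i.
case E : (tnth Y i) => [s| |] // _.
  rewrite (prefix_sum_fin ik E) /=; apply/power_limitP; rewrite opprB.
  exact: (tends_scaled_coef Pc_monic YfP s k).
have -> : prefix_sum k = +oo%E.
  apply/esum_eqyP => [j _|]; first exact: YN.
  by exists i; split => //; rewrite -ik ltnSn.
rewrite /=; have [_ _ hY _] := YfP.
have Y0 : \forall e \near 0^'+, forall j : 'I_n, (i <= j)%N -> Yf j e = 0.
  apply: filter_forall => j; have [ij|] := leqP i j; last by move=> _; apply: nearW.
  have := hY j; have := Yle ij; rewrite E leye_eq => /eqP -> /=.
  by apply: filterS.
apply: filterS2 Y0 (near_factored Pc_monic YfP) => e e0 fE.
rewrite -coef_poly_at fE (coef_prod_tailX _ (ltnW (ltn_ord i))) => [|j ij]; last first.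
  by rewrite e0 ?subr0.
by rewrite ifT // /=; have := ltn_ord k; lia.
Qed.

(** If the next exponent is strictly larger, exactly [k] factors of the limit
    are equal to ['X], and the others have a non-zero constant term. *)
Lemma root_coef_neq0 (k : 'I_n.+1) (i : 'I_n) s : i.+1 = (n - k)%N ->
  tnth Y i = s%:E -> (forall j : 'I_n, (i < j)%N -> (s%:E < tnth Y j)%E) ->
  root_coef k != 0.
Proof.
move=> ik Yi hlt; have := ltn_ord i => lin.
have kn : k != n :> nat by apply: contraTneq lin => kn; lia.
rewrite /root_coef (negbTE kn) -ik /= -(tnth_nth +oo%E) Yi /= /limit_poly.
rewrite (@coef_prod_tailX _ _ i.+1) //; last first.
  move=> j /hlt lt; rewrite /scaled_factor ltNge ltW //=.
  by rewrite gt_eqF.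
have -> : (n - i.+1 = k)%N by have := ltn_ord k; lia.
rewrite ltnn subnn -horner_coef0 horner_prod; apply/prodf_neq0 => j ji.
have [_ _ hY _] := YfP; have aY := hY j; have NY := YN j.
have leY : (tnth Y j <= s%:E)%E by rewrite -Yi Yle // -ltnS.
rewrite /scaled_factor; case: (tnth Y j) leY NY aY => [r| |] leY NY //.
move: leY NY.
rewrite le_eqVlt eqe lte_fin => /orP[/eqP -> _ [y0 _]|rs _ [y0 _]].
  by rewrite ltxx eqxx hornerXsubC sub0r oppr_eq0.
by rewrite rs hornerC oppr_eq0.
Qed.

Lemma roots_to_coefs :
  exists (p : {poly R[i]}) (P : 'I_n.+1 -> \bar R), coef_asymp Pc p P Y.
Proof.
exists (\poly_(k < n.+1) root_coef k), prefix_sum; split.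
- split=> [|j]; first exact: size_poly.
  by rewrite coef_poly ltn_ord; exact: root_coef_asymp.
- rewrite coef_poly ltnSn /root_coef eqxx; split=> //.
  by rewrite /prefix_sum big_pred0 // => j; rewrite /= subnn.
- rewrite coef_poly /=; case: (posnP n) => [n0|n0].
    by left; rewrite /root_coef ifT ?oner_neq0 // n0.
  have lin : (n.-1 < n)%N by rewrite prednK.
  pose i := Ordinal lin.
  have ik : i.+1 = (n - @ord0 n)%N by rewrite /= prednK // subn0.
  case E : (tnth Y i) => [s| |]; last by have := YN i; rewrite E.
    left; apply: (root_coef_neq0 (k := ord0) ik E) => j ij.
    by have := ltn_ord j; rewrite /= in ij; lia.
  right; apply/esum_eqyP => [j _|]; first exact: YN.
  by exists i; split => //; rewrite -ik ltnSn.
- exact: prefix_roots.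
- move=> i /andP[i1 i2] lt.
  have kn : (n - i < n.+1)%N by rewrite ltnS leq_subr.
  rewrite coef_poly kn.
  have lin : (i.-1 < n)%N by lia.
  pose i' := Ordinal lin.
  have ik : i'.+1 = (n - Ordinal kn)%N by rewrite /=; lia.
  have Ei : tnth Y i' = nth +oo%E Y i.-1 by rewrite (tnth_nth +oo%E).
  case E : (tnth Y i') => [s| |]; last by have := YN i'; rewrite E.
    apply: (root_coef_neq0 (k := Ordinal kn) ik E) => j ij.
    rewrite -E Ei; apply: (lt_le_trans lt); rewrite (tnth_nth +oo%E).
    apply: (sorted_leq_nth le_trans le_refl _ sY); rewrite ?inE ?size_tuple //.
      by lia.
    by move: ij => /=; lia.
  by move: lt; rewrite -Ei E ltNge leey.
Qed.

End RootsToCoefs.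

(** * Asymptotics of a continuous root *)

Section Continuity.
Variable R : realType.
Implicit Types (e r a : R).

Lemma tends_at_powR e a : 0 < e ->
  tends (nbhs e) (fun u => (u `^ a)%:C) (e `^ a)%:C.
Proof.
move=> e0.
have : {for e, continuous (@powR R ^~ a)}.
  apply: differentiable_continuous; apply/derivable1_diffP.
  by apply: derivable_powR; rewrite in_itv /= e0.
move=> /cvgr_dist_lt h eta eta0; apply: filterS (h eta eta0) => u.
by rewrite -rmorphB normc_real.
Qed.

Lemma tends_normc_lt (T : Type) (F : set_system T) {FF : Filter F} (g : T -> R[i])
    z (b : R) : tends F g z -> normc z < b -> \forall x \near F, normc (g x) < b.
Proof.
move=> gz zb; have h := gz (b - normc z); rewrite subr_gt0 in h.
apply: filterS (h zb) => x; have := le_normc_dist (g x) z; rewrite (normcB (g x)); lra.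
Qed.

Lemma tends_normc_gt (T : Type) (F : set_system T) {FF : Filter F} (g : T -> R[i])
    z (b : R) : tends F g z -> b < normc z -> \forall x \near F, b < normc (g x).
Proof.
move=> gz zb; have h := gz (normc z - b); rewrite subr_gt0 in h.
apply: filterS (h zb) => x; have := le_normc_dist z (g x); lra.
Qed.

Lemma tends0_bounded (T : Type) (F : set_system T) {FF : Filter F} (u v : T -> R[i])
    (K : R) : tends F u 0 -> (\forall x \near F, normc (v x) <= K) ->
  tends F (fun x => u x * v x) 0.
Proof.
move=> u0 vK eta eta0.
have K0 : 0 < `|K| + 1 by rewrite ltr_wpDl.
have e0 : 0 < eta / (`|K| + 1) by rewrite divr_gt0.
apply: filterS2 vK (u0 _ e0) => x xK; rewrite !sub0r !normcN normcM.
rewrite ltr_pdivlMr // => lt; apply: le_lt_trans lt.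
rewrite ler_wpM2l ?normc_ge0 // (le_trans xK) // (le_trans (ler_norm K)) //.
by rewrite lerDl.
Qed.

Lemma near_itv (r e : R) : 0 < e < r -> \forall u \near e, 0 < u < r.
Proof.
move=> /andP[e0 er]; near=> u; apply/andP; split.
  by near: u; exact: lt_nbhsr.
by near: u; exact: lt_nbhsl.
Unshelve. all: by end_near. Qed.

(** An interval is not a disjoint union of several non-empty open sets. *)
Lemma connected_cover (T : Type) (r : R) (A : T -> R -> Prop) : 0 < r ->
  (forall t e, 0 < e < r -> A t e -> \forall u \near e, A t u) ->
  (forall t t' e, 0 < e < r -> A t e -> A t' e -> t = t') ->
  (forall e, 0 < e < r -> exists t, A t e) ->
  exists t, forall e, 0 < e < r -> A t e.
Proof.
move=> r0 oA disj cov.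
have r2 : 0 < r / 2 < r by apply/andP; split; lra.
have [t At] := cov _ r2; exists t.
pose I : set R := `]0, r[%classic.
have IE e : I e <-> 0 < e < r by rewrite /I /= in_itv.
have cI : connected I by apply/connected_intervalP; exact: interval_is_interval.
pose B := [set e | I e /\ A t e]; pose C := [set e | I e /\ ~ A t e].
have oB : open B.
  rewrite openE => e [/IE Ie Ae]; rewrite /interior.
  by apply: filterS2 (near_itv Ie) (oA t e Ie Ae) => u Iu Au; split => //; exact/IE.
have oC : open C.
  rewrite openE => e [/IE Ie nAe]; rewrite /interior.
  have [t' At'] := cov e Ie.
  apply: filterS2 (near_itv Ie) (oA t' e Ie At') => u Iu Au; split; first exact/IE.
  by move=> Atu; apply: nAe; rewrite (disj t t' u Iu Atu Au).
have BI : B = I.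
  apply: cI; first by exists (r / 2); split => //; exact/IE.
    by exists B => //; apply/seteqP; split=> [e [Ie Ae]|e [_ //]]; split.
  exists (~` C); first exact: open_closedC.
  apply/seteqP; split=> [e [Ie Ae]|e [Ie nC]]; split=> //; first by move=> [].
  by apply: contrapT => nA; apply: nC.
by move: BI => /seteqP[_ sub] e /IE /sub[].
Qed.

End Continuity.

(** The term of index [k] is the opposite of the sum of the [n] others. *)
Lemma root_dominated (R : realType) n (q : {poly R[i]}) (z : R[i]) (k : 'I_n.+1)
    (b : R) : (size q <= n.+1)%N -> root q z ->
  (forall j : 'I_n.+1, j != k -> normc (q`_j * z ^+ j) <= b) ->
  normc (q`_k * z ^+ k) <= n%:R * b.
Proof.
move=> sq /rootP; rewrite (horner_coef_wide _ sq) (bigD1 k) //= => /eqP.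
rewrite addr_eq0 => /eqP -> h; rewrite normcN.
apply: (le_trans (normc_sum _ _ _)); apply: (le_trans (ler_sum _ h)).
by rewrite sumr_const cardC1 card_ord mulr_natl.
Qed.

Lemma separated_exists (R : realType) (rs : seq R[i]) : exists2 d : R, 0 < d &
  forall z z', z \in rs -> z' \in rs -> z != z' -> 2 * d <= normc (z - z').
Proof.
have one (w : R[i]) (l : seq R[i]) : exists2 d : R, 0 < d &
    forall z, z \in l -> w != z -> 2 * d <= normc (w - z).
  elim: l => [|a l [d d0 IH]]; first by exists 1.
  have [wa|wa] := eqVneq w a.
    by exists d => // z; rewrite inE => /orP[/eqP ->|/IH //]; rewrite wa eqxx.
  exists (Num.min d (normc (w - a) / 2)).
    by rewrite lt_min d0 divr_gt0 // normc_gt0 subr_eq0.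
  move=> z; rewrite inE mulrC -ler_pdivlMr // ge_min => /orP[/eqP ->|/IH h /h le].
    by rewrite lexx orbT.
  by rewrite ler_pdivlMr // mulrC le.
elim: rs => [|w l [d d0 IH]]; first by exists 1.
have [d' d'0 h] := one w l; exists (Num.min d d'); first by rewrite lt_min d0.
move=> z z'; rewrite !inE mulrC -ler_pdivlMr // ge_min !ler_pdivlMr // ![_ * 2]mulrC.
move=> /orP[/eqP ->|zl] /orP[/eqP ->|zl'].
- by rewrite eqxx.
- by move=> /(h z' zl') ->; rewrite orbT.
- by rewrite eq_sym normcB => /(h z zl) ->; rewrite orbT.
- by move=> /(IH z z' zl zl') ->.
Qed.

Section RootAsymptotics.
Variables (R : realType) (n : nat) (Pc : 'I_n.+1 -> R -> R[i]).
Variables (p : {poly R[i]}) (P : 'I_n.+1 -> \bar R) (c : n.-tuple (\bar R)).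
Hypothesis PcP : coef_asymp Pc p P c.

Let hP j : weak_asymp (Pc j) p`_j (P j).
Proof. by have [[_ h] _ _ _ _] := PcP. Qed.
Let P0 : P ord_max = 0%E. Proof. by have [_ []] := PcP. Qed.
Let Prc : minplus_roots P c. Proof. by have [] := PcP. Qed.

(** Uniform in the index, the scale and the level: the coefficient terms at scale
    [e^t] are controlled by the value of their min-plus counterparts. *)
Lemma near_coef_ub : exists2 C : R, 0 < C & \forall e \near 0^'+,
  forall (j : 'I_n.+1) (m t : R), (m%:E <= P j + (j%:R * t)%:E)%E ->
    normc (Pc j e) * e `^ (j%:R * t) <= C * e `^ m.
Proof.
exists (1 + \sum_(j < n.+1) (normc p`_j + 1)).
  by rewrite ltr_wpDr // sumr_ge0 // => j _; rewrite addr_ge0 ?normc_ge0.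
apply: filter_forall => j; have := hP j; set C := 1 + _.
have Cj : normc p`_j + 1 <= C.
  rewrite /C (bigD1 j) //= addrCA lerDl addr_ge0 // sumr_ge0 // => i _.
  by rewrite addr_ge0 ?normc_ge0.
have C0 : 0 <= C by apply: le_trans Cj; rewrite addr_ge0 ?normc_ge0.
case: (P j) => [B| |] //= h; last first.
  apply: filterS h => e -> m t _; rewrite normc0 mul0r.
  by rewrite mulr_ge0 ?powR_ge0.
apply: filterS2 (near_right ltr01) (power_limit_ub h) => e /andP[e0 e1] ub m t.
rewrite -EFinD lee_fin => mB.
apply: (@le_trans _ _ (C * e `^ B * e `^ (j%:R * t))).
  rewrite ler_wpM2r ?powR_ge0 // (le_trans ub) // ler_wpM2r ?powR_ge0 //.
rewrite -mulrA -powRD_gt0 // ler_wpM2l //; apply: ger_powR => //.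
by rewrite e0 ltW.
Qed.

(** A non-zero [p`_j] determines the exact size of the coefficient. *)
Lemma near_coef_lb : exists2 a : R, 0 < a & \forall e \near 0^'+,
  forall (j : 'I_n.+1) (m t : R), p`_j != 0 -> (P j + (j%:R * t)%:E = m%:E)%E ->
    a * e `^ m <= normc (Pc j e) * e `^ (j%:R * t).
Proof.
pose a := \big[Num.min/1]_(j < n.+1 | p`_j != 0) (normc p`_j / 2).
have a0 : 0 < a.
  by apply: lt_bigmin => [//|j pj]; rewrite divr_gt0 // normc_gt0.
exists a => //; apply: filter_forall => j; have := hP j.
have [pj0 _|pj] := eqVneq p`_j 0; first by apply: nearW => e m t; rewrite ?pj0 ?eqxx.
case: (P j) => [B| |] //= h; last by apply: nearW => e m t.
apply: filterS2 (nbhs_right_gt 0) (power_limit_lb h pj) => e e0 lb m t _.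
rewrite -EFinD => -[<-]; rewrite powRD_gt0 // mulrA ler_wpM2r ?powR_ge0 //.
apply: le_trans lb; rewrite ler_wpM2r ?powR_ge0 //.
exact: bigmin_le_cond.
Qed.

(** Write |z| = e^s and M = e^(-d).  If no finite entry of [c] is within [d] of
    [s], [minplus_vertex] provides an index whose term has size e^(F(s)) at least
    up to a constant, while all the others are smaller by a factor M; for M large
    this contradicts [root_dominated]. *)
Lemma root_annulus : exists2 M : R, 1 < M & \forall e \near 0^'+,
  forall z, z != 0 -> root (poly_at Pc e) z ->
    exists r, [/\ r%:E \in c, e `^ r <= M * normc z & normc z <= M * e `^ r].
Proof.
have [C C0 ub] := near_coef_ub; have [a a0 lb] := near_coef_lb.
(* Chosen so that M > 1 and n C < a M. *)
pose M : R := n%:R * C / a + 2.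
have nCa : 0 <= n%:R * C / a by apply: divr_ge0; [apply: mulr_ge0 => //; exact: ltW | exact: ltW].
have M1 : 1 < M by rewrite /M; lra.
have aM : n%:R * C < a * M.
  rewrite /M mulrDr mulrCA divff ?gt_eqF // mulr1; lra.
have M0 : 0 < M by rewrite (lt_trans ltr01).
exists M => //.
apply: filterS3 (near_right ltr01) ub lb => e /andP[e0 e1] {}ub {}lb z z0 rz.
have lne0 : ln e < 0 by rewrite ln_lt0 // e0.
have nz : 0 < normc z by rewrite normc_gt0.
pose s := ln (normc z) / ln e; pose d := ln M / - ln e.
have zE : normc z = e `^ s.
  by rewrite /powR gt_eqF // /s divfK ?lt_eqF // lnK.
have dE : e `^ d = M^-1.
  by rewrite /powR gt_eqF // /d invrN mulrN mulNr divfK ?lt_eqF // expRN lnK.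
have d0 : 0 < d by rewrite divr_gt0 ?oppr_gt0 // ln_gt0.
apply: contrapT => nor.
have gc : gap c s d.
  move=> x xc; case: x xc => [r| |] xc; [|by right; rewrite leey|by left; rewrite leNye].
  rewrite !lee_fin; have [le|lt1] := leP r (s - d); first by left.
  have [le|lt2] := leP (s + d) r; first by right.
  exfalso; apply: nor; exists r; split => //.
    rewrite -ler_pdivrMl // -dE -powRD_gt0 // zE; apply: ger_powR; rewrite ?e0 ?(ltW e1) //.
    by lra.
  rewrite mulrC -ler_pdivrMr // zE -dE -powRD_gt0 //; apply: ger_powR; rewrite ?e0 ?(ltW e1) //.
  by lra.
have [hk far] := minplus_vertex P0 Prc d0 gc.
have pk := vertex_neq0 PcP d0 gc.
have nE (j : 'I_n.+1) : normc ((poly_at Pc e)`_j * z ^+ j) = normc (Pc j e) * e `^ (j%:R * s).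
  rewrite coef_poly_at normcM normcX zE; congr (_ * _).
  by rewrite -powR_mulrn ?powR_ge0 // -powRrM mulrC.
have := @root_dominated R n (poly_at Pc e) z (vertex c s d) (C * e `^ (sum_min c s + d)).
have ubj : forall j : 'I_n.+1, j != vertex c s d ->
   normc ((poly_at Pc e)`_j * z ^+ j) <= C * e `^ (sum_min c s + d).
  by move=> j /far le; rewrite nE; exact: ub.
move=> /(_ (size_poly_at _ _) rz ubj); rewrite nE.
have : a * e `^ (sum_min c s) <= normc (Pc (vertex c s d) e) * e `^ ((vertex c s d)%:R * s).
  by apply: lb => //; apply: hk; rewrite subrr normr0 ltW.
move=> h1 h2; have := le_trans h1 h2.
rewrite powRD_gt0 // dE !mulrA mulrAC.
rewrite ler_pM2r ?powR_gt0 // ler_pdivlMr // => h3.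
by move: aM; rewrite ltNge h3.
Qed.

Variables (f : R -> R[i]) (r0 : R).
Hypothesis r00 : 0 < r0.
Hypothesis f_cont : forall e, 0 < e < r0 -> tends (nbhs e) f (f e).
Hypothesis f_root : forall e, 0 < e < r0 -> root (poly_at Pc e) (f e).

Let g r e : R[i] := (e `^ (- r))%:C * f e.

Let g_cont r e : 0 < e < r0 -> tends (nbhs e) (g r) (g r e).
Proof.
move=> e0; apply: tendsM (f_cont e0).
by apply: tends_at_powR; case/andP: e0.
Qed.

Let normc_g r e : 0 < e -> normc (g r e) = normc (f e) / e `^ r.
Proof. exact: normc_scaled. Qed.

(** This makes the annuli of [root_annulus] disjoint for small [e]. *)
Lemma near_scales_separated (K : R) : 0 < K -> \forall e \near 0^'+,
  forall r r', r%:E \in c -> r'%:E \in c -> r < r' -> K * e `^ r' < e `^ r.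
Proof.
move=> K0.
have : \forall e \near 0^'+, forall i j : 'I_n,
    forall r r', tnth c i = r%:E -> tnth c j = r'%:E -> r < r' -> K * e `^ r' < e `^ r.
  apply: filter_forall => i; apply: filter_forall => j.
  case: (tnth c i) => [r| |]; [|by apply: nearW => e r r'..].
  case: (tnth c j) => [r'| |]; [|by apply: nearW => e s s'..].
  have [lt|le] := ltP r r'; last first.
    by apply: nearW => e s s' [<-] [<-]; rewrite ltNge le.
  have d0 : 0 < r' - r by rewrite subr_gt0.
  have Ki : 0 < K^-1 by rewrite invr_gt0.
  apply: filterS2 (nbhs_right_gt 0) (near_powR_small d0 Ki) => e e0 lte s s' [<-] [<-] _.
  have -> : e `^ r' = e `^ (r' - r) * e `^ r by rewrite -powRD_gt0 // subrK.
  rewrite mulrA gtr_pMl ?powR_gt0 // mulrC -ltr_pdivlMr // div1r.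
  exact: lte.
apply: filterS => e h r r' /tnthP[i ri] /tnthP[j rj].
exact: h (esym ri) (esym rj).
Qed.

(** The annuli of [root_annulus], slightly enlarged to be open, together with a
    neighbourhood of 0 smaller than all of them, cover the values of [f] and
    are disjoint: connectedness selects one.  In the neighbourhood of 0, [f] can
    only vanish. *)
Lemma single_scale : (\forall e \near 0^'+, f e = 0) \/
  exists r M, 0 < M /\ \forall e \near 0^'+, M^-1 < normc (g r e) < M.
Proof.
have [M M1 hM] := root_annulus.
pose M' := M + 1; have M0 : 0 < M' by rewrite /M'; lra.
(* The scale e^N is negligible with respect to all the annuli: the margin 1
   makes e^(N - r) at most e. *)
have [N hN] : exists N, forall r, r%:E \in c -> r + 1 <= N.
  have : exists N, forall x, x \in val c -> fine x + 1 <= N.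
    elim: (val c) => [|x l [N NP]]; first by exists 0.
    exists (Num.max N (fine x + 1)) => z; rewrite inE => /orP[/eqP ->|/NP le].
      by rewrite le_max lexx orbT.
    by rewrite le_max le.
  by move=> [N NP]; exists N => r /NP.
pose A (t : option R) e := if t is Some r then
  r%:E \in c /\ M'^-1 < normc (g r e) < M' else normc (g N e) < 1.
have sep := near_scales_separated (K := M' * M'); rewrite mulr_gt0 // in sep.
have Mi : 0 < M'^-1 by rewrite invr_gt0.
have e1M : 0 < Num.min 1 M'^-1 by rewrite lt_min ltr01.
have [r1 r10 h1] := near_right_ex (filterI (near_right e1M)
  (filterI (near_right r00) (filterI hM (sep isT)))).
have disjN r e : 0 < e < r1 -> A (Some r) e -> A None e -> False.
  move=> er [rc /andP[l _]].
  have [] := h1 e er; rewrite lt_min => /andP[e0 /andP[e1 eM]] _.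
  rewrite /= normc_g // in l *; rewrite normc_g // ltr_pdivrMr ?powR_gt0 // mul1r => l2.
  move: l; rewrite ltr_pdivlMr ?powR_gt0 // => l.
  have := lt_trans l l2; apply/negP; rewrite -leNgt.
  have -> : e `^ N = e `^ (N - r) * e `^ r by rewrite -powRD_gt0 // subrK.
  rewrite ler_wpM2r ?powR_ge0 //; apply: le_trans (ltW eM).
  rewrite -[leRHS](powRr1 (ltW e0)); apply: ger_powR; first by rewrite e0 (ltW e1).
  by have := hN r rc; lra.
have disj2 r r' e : 0 < e < r1 -> A (Some r) e -> A (Some r') e -> r < r' -> False.
  move=> er [rc /andP[l _]] [rc' /andP[_ u]] lt.
  have [] := h1 e er; rewrite lt_min => /andP[e0 _] [_ [_ /(_ r r' rc rc' lt)]].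
  move: l u; rewrite !normc_g // ltr_pdivlMr ?powR_gt0 // ltr_pdivrMr ?powR_gt0 //.
  move=> l u; rewrite -mulrA => l2.
  have : M' * (M'^-1 * e `^ r) < M' * (M' * e `^ r').
    by rewrite ltr_pM2l // (lt_trans l u).
  by rewrite mulVKf ?gt_eqF // ltNge ltW.
have e_r0 e : 0 < e < r1 -> 0 < e < r0 by move=> /h1[_ []].
have covS e : 0 < e < r1 -> f e != 0 -> exists r, A (Some r) e.
  move=> er fe0; have /andP[e0 _] := er.
  have [_ [_ [hz _]]] := h1 e er.
  have [r [rc l u]] := hz (f e) fe0 (f_root (e_r0 _ er)).
  exists r; split=> //.
  rewrite normc_g // ltr_pdivlMr ?powR_gt0 // ltr_pdivrMr ?powR_gt0 //.
  rewrite mulrC ltr_pdivrMr // (le_lt_trans l) /=; last first.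
    by rewrite mulrC ltr_pM2l ?normc_gt0 // /M' ltrDl.
  by rewrite (le_lt_trans u) // ltr_pM2r ?powR_gt0 // /M' ltrDl.
have cov e : 0 < e < r1 -> exists t, A t e.
  move=> er; have [fe0|/(covS e er)[r Ar]] := eqVneq (f e) 0; last by exists (Some r).
  by exists None; rewrite /A /g fe0 mulr0 normc0.
have [|||t At] := @connected_cover R (option R) r1 A r10.
- move=> [r|] e er /=; last first.
    by move=> lt; apply: tends_normc_lt (g_cont N (e_r0 _ er)) lt.
  move=> [rc /andP[l u]].
  have gl : \forall e' \near e, M'^-1 < normc (g r e').
    exact: tends_normc_gt (g_cont r (e_r0 _ er)) l.
  have gu : \forall e' \near e, normc (g r e') < M'.
    exact: tends_normc_lt (g_cont r (e_r0 _ er)) u.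
  by apply: filterS2 gl gu => e' l' u'; split=> //; apply/andP.
- move=> [r|] [r'|] e er Ar Ar' //.
  + have [lt|lt|-> //] := ltgtP r r'; first by case: (disj2 r r' e er Ar Ar' lt).
    by case: (disj2 r' r e er Ar' Ar lt).
  + by case: (disjN r e er Ar Ar').
  + by case: (disjN r' e er Ar' Ar).
- exact: cov.
case: t At => [r|] At; [right|left].
  by exists r, M'; split => //; apply: filterS (near_right r10) => e /At[].
apply: filterS (near_right r10) => e er; apply/eqP; apply: contraT => /(covS e er)[r Ar].
by case: (disjN r e er Ar (At e er)).
Qed.

(** The scaled root is bounded and away from 0, and the saturated part [q] tends
    to 0 along it; it is therefore close to the finite set of roots of [q], hence,
    by connectedness, to a single one of them. *)
Lemma scaled_root_limit r (M : R) : 0 < M ->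
  (\forall e \near 0^'+, M^-1 < normc (g r e) < M) ->
  exists2 z, z != 0 & power_limit f z r.
Proof.
move=> M0 gM; pose q := saturated_part p P r.
have mE := minplus_rootsE P0 Prc r.
have q0 : q != 0.
  have [d d0 gc] := right_gap c r.
  have pk := vertex_neq0 PcP d0 gc; have [hk _] := minplus_vertex P0 Prc d0 gc.
  apply: contraNneq pk => qe; have := coef_saturated_part p P r (vertex c (r + d) d).
  rewrite -/q qe coef0 mE hk ?eqxx => [<- //|].
  by rewrite opprD addNKr normrN gtr0_norm.
have [rs qE] := closed_field_poly_normal q.
have l0 : lead_coef q != 0 by rewrite lead_coef_eq0.
have qg : tends 0^'+ (fun e => q.[g r e]) 0.
  have : tends 0^'+ (fun e => \sum_(k < n.+1)
     (q`_k - (e `^ (k%:R * r - sum_min c r))%:C * Pc k e) * g r e ^+ k) 0.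
    have z0 : \sum_(k < n.+1) (0 : R[i]) = 0 by rewrite big1.
    rewrite -[X in tends _ _ X]z0.
    apply: tends_sum => k _; apply: (tends0_bounded (K := M ^+ k)).
      have h0 : tends 0^'+ (fun e => q`_k - (e `^ (k%:R * r - sum_min c r))%:C * Pc k e)
          (q`_k - q`_k).
        apply: tendsD; first exact: tends_cst.
        by apply: tendsN; exact: tends_saturated_coef.
      by rewrite subrr in h0.
    apply: filterS gM => e /andP[_ lt]; rewrite normcX lerXn2r ?nnegrE ?normc_ge0 // ltW //.
  apply: tends_near; apply: filterS (near_right r00) => e er; have /andP[e0 _] := er.
  rewrite (horner_coef_wide _ (size_saturated_part p P r)) -[RHS]subr0.
  under eq_bigr do rewrite mulrBl.
  rewrite sumrB; congr (_ - _).
  have := f_root er; rewrite /root (horner_coef_wide _ (size_poly_at _ _)) => /eqP fr.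
  transitivity ((e `^ (- sum_min c r))%:C * \sum_(k < n.+1) (poly_at Pc e)`_k * f e ^+ k);
    last by rewrite fr mulr0.
  rewrite mulr_sumr; apply: eq_bigr => k _; rewrite coef_poly_at /g exprMn mulrACA.
  congr (_ * _); rewrite -rmorphXn -rmorphM /=; congr (_%:C).
  rewrite -powR_mulrn ?powR_ge0 // -powRrM -powRD_gt0 //; congr (_ `^ _).
  by ring.
have near_rs d : 0 < d -> \forall e \near 0^'+, exists2 z, z \in rs & normc (z - g r e) < d.
  move=> d0; have ld : 0 < normc (lead_coef q) * d ^+ size rs.
    by rewrite mulr_gt0 ?exprn_gt0 // normc_gt0.
  apply: filterS (qg _ ld) => e; rewrite sub0r normcN => lt.
  apply: contrapT => nz; move: lt; apply/negP; rewrite -leNgt {2}qE hornerZ normcM.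
  rewrite ler_wpM2l ?normc_ge0 //; apply: normc_horner_ge (ltW d0) _ => z zr.
  by rewrite leNgt; apply/negP => lt; apply: nz; exists z => //; rewrite normcB.
have [d0 d00 sep] := separated_exists rs.
have [r1 r10 h1] := near_right_ex (filterI (near_right r00) (near_rs d0 d00)).
pose A z e := z \in rs /\ normc (z - g r e) < d0.
have disj z z' e : A z e -> A z' e -> z = z'.
  move=> [zr lt] [zr' lt']; apply/eqP; apply: contraT => zz.
  have := sep z z' zr zr' zz; rewrite leNgt => /negP; case.
  have -> : z - z' = (z - g r e) - (z' - g r e) by ring.
  by apply: le_lt_trans (le_normcD _ _) _; rewrite normcN mulr2n mulrDl mul1r ltrD.
have [|||z Az] := @connected_cover R R[i] r1 A r10.
- move=> z e er [zr lt].
  have hz : tends (nbhs e) (fun u => z - g r u) (z - g r e).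
    apply: tendsD; first exact: tends_cst.
    by apply: tendsN; apply: g_cont; have [] := h1 e er.
  have hl : \forall u \near e, normc (z - g r u) < d0 by exact: tends_normc_lt hz lt.
  by apply: filterS hl => u lu; split.
- by move=> z z' e _; exact: disj.
- by move=> e er; have [_ [z zr lt]] := h1 e er; exists z.
have zlim : tends 0^'+ (g r) z.
  move=> d dp; have md : 0 < Num.min d d0 by rewrite lt_min dp.
  have hd := near_rs _ md; have hr := near_right r10.
  apply: filterS2 hr hd => e er [z' zr'].
  rewrite lt_min => /andP[lt lt0].
  by rewrite (disj z z' e (Az e er) (conj zr' lt0)).
exists z; last exact/power_limitP.
apply: contraTneq M0 => z0; rewrite -leNgt.
have zl := zlim M^-1; rewrite leNgt; apply/negP => M0.
have Mi : 0 < M^-1 by rewrite invr_gt0.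
have h2 : \forall e \near 0^'+,
    M^-1 < normc (g r e) /\ normc (z - g r e) < M^-1.
  by apply: filterS2 gM (zl Mi) => e /andP[].
case: (@filter_ex _ (0^'+ : set_system R) _ _ h2) => e [l u].
rewrite z0 sub0r normcN in u.
by have := lt_trans l u; rewrite ltxx.
Qed.

End RootAsymptotics.

(** * From coefficients to roots *)

Section Germs.
Variable R : realType.
Implicit Types (f : R -> R[i]).

Lemma within_itv_tends f (r : R) :
  {within `]0, r[, continuous (f : R -> R[i]^o)} <->
  forall e, 0 < e < r -> tends (nbhs e) f (f e).
Proof.
rewrite continuous_open_subspace; last exact: interval_open.
split=> h e.
  by move=> er; apply/tendsP; apply: h; rewrite inE /= in_itv.
by rewrite inE /= in_itv /= => /h /tendsP.
Qed.

Lemma germ_tends f : is_germ f -> \forall e \near 0^'+, tends (nbhs e) f (f e).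
Proof.
move=> [r [k [r0 _ /within_itv_tends h _]]].
by apply: filterS (near_right r0) => e /h.
Qed.

(** A function with first order asymptotics has polynomial growth, whatever the
    sign of its exponent. *)
Lemma asymp_germ f (r0 : R) b B : 0 < r0 ->
  (forall e, 0 < e < r0 -> tends (nbhs e) f (f e)) -> asymp f b B -> is_germ f.
Proof.
move=> r00 fc fb.
suff [k k0 hk] : exists2 k : R, 0 < k &
    \forall e \near 0^'+, normc (f e) <= e `^ (- k).
  have [r r_0 h] := near_right_ex (filterI (near_right r00) hk).
  exists r, k; split=> //; last by move=> e /h[].
  by apply/within_itv_tends => e /h[+ _]; exact: fc.
case: B fb => [B| |] //= => [[_ fb]|f0]; last first.
  by exists 1 => //; apply: filterS f0 => e ->; rewrite normc0 powR_ge0.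
have C0 : 0 < normc b + 1 by rewrite ltr_wpDl ?normc_ge0.
exists (`|B| + 1); first by rewrite ltr_wpDl.
(* One more power of 1 / e absorbs the constant |b| + 1. *)
have m0 : 0 < Num.min 1 (normc b + 1)^-1 by rewrite lt_min ltr01 invr_gt0.
apply: filterS2 (near_right m0) (power_limit_ub fb) => e.
rewrite lt_min => /and3P[e0 e1 eC] ub; apply: (le_trans ub).
rewrite opprD powRD_gt0 // mulrC; apply: ler_pM; rewrite ?powR_ge0 ?(ltW C0) //.
  by apply: ger_powR; rewrite ?e0 ?(ltW e1) // lerNl -normrN ler_norm.
by rewrite powR_inv1 ?(ltW e0) // -[leLHS]invrK lef_pV2 ?posrE ?invr_gt0 // ltW.
Qed.

End Germs.

Section CoefsToRoots.
Variables (R : realType) (n : nat) (Pc : 'I_n.+1 -> R -> R[i]).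
Hypothesis Pc_germ : forall j, is_germ (Pc j).
Hypothesis Pc_monic : \forall e \near 0^'+, Pc ord_max e = 1.

(** Continuity and monicity hold on a common interval, to which
    [continuous_roots] applies. *)
Lemma continuous_root_germs : exists2 r : R, 0 < r &
  exists Yf : 'I_n -> R -> R[i], forall e, 0 < e < r ->
    poly_at Pc e = \prod_(i < n) ('X - (Yf i e)%:P) /\
    forall i, tends (nbhs e) (Yf i) (Yf i e).
Proof.
have cont : \forall e \near 0^'+, forall j, tends (nbhs e) (Pc j) (Pc j e).
  by apply: filter_forall => j; exact: germ_tends.
have [r r0 h] := near_right_ex (filterI Pc_monic cont).
exists r => //.
have IE e : `]0, r[%classic e <-> 0 < e < r by rewrite /= in_itv.
have [|e /IE er|e /IE er k|Yf YfP] :=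
    @continuous_roots R n `]0, r[%classic (poly_at Pc).
- exact: interval_open.
- by have [/monic_poly_at[]] := h e er.
- have [kn|nk] := ltnP k n.+1.
    rewrite (coef_poly_at Pc e (Ordinal kn)).
    apply: (tends_eq (f := Pc (Ordinal kn))); last by have [_] := h e er.
    by move=> u; rewrite (coef_poly_at Pc u (Ordinal kn)).
  apply: (tends_eq (f := fun=> 0)); last by rewrite coef_poly_at_gt //; exact: tends_cst.
  by move=> u; rewrite coef_poly_at_gt.
by exists Yf => e /IE /YfP.
Qed.

(** The continuous roots each have first order asymptotics; it remains to
    renumber them by increasing exponent. *)
Lemma coefs_to_roots (p : {poly R[i]}) (P : 'I_n.+1 -> \bar R) (c : n.-tuple (\bar R)) :
  coef_asymp Pc p P c ->
  exists (Yf : 'I_n -> R -> R[i]) (y : n.-tuple R[i]) (Y : n.-tuple (\bar R)),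
    root_asymp Pc Yf y Y.
Proof.
move=> PcP; have [r r0 [Yf YfP]] := continuous_root_germs.
have Yroot i e : 0 < e < r -> root (poly_at Pc e) (Yf i e).
  move=> /YfP[-> _]; apply/rootP; rewrite horner_prod (bigD1 i) //=.
  by rewrite hornerXsubC subrr mul0r.
have /choice[zB zBP] : forall i, exists zB, asymp (Yf i) zB.1 zB.2.
  move=> i.
  have Ycont e : 0 < e < r -> tends (nbhs e) (Yf i) (Yf i e) by move=> /YfP[_].
  have [Y0|[s [M [M0 sM]]]] := single_scale PcP r0 Ycont (Yroot i).
    by exists (0, +oo%E).
  have [z z0 zl] := scaled_root_limit PcP r0 Ycont (Yroot i) M0 sM.
  by exists (z, s%:E).
pose B := [tuple (zB i).2 | i < n].
have [sg sgP] := perm_eq_nthP +oo%E (size_tuple B) (permEl (perm_sort <=%O B)).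
have BE (i : 'I_n) : nth +oo%E (sort <=%O B) i = (zB (sg i)).2 :> \bar R.
  by rewrite sgP -tnth_nth tnth_mktuple.
exists (fun i => Yf (sg i)), [tuple (zB (sg i)).1 | i < n], [tuple (zB (sg i)).2 | i < n].
split.
- by move=> j; apply: asymp_germ r0 _ (zBP (sg j)) => e /YfP[].
- apply: filterS (near_right r0) => e /YfP[-> _].
  rewrite (reindex_perm sg) -(big_map (fun j => Yf (sg j) e) predT (fun z => 'X - z%:P)).
  by rewrite -[index_enum _]enumT; exact: root_list_prod.
- by move=> j; rewrite !tnth_mktuple.
- have -> : val [tuple (zB (sg i)).2 | i < n] = sort <=%O B.
    apply: (@eq_from_nth _ +oo%E); first by rewrite size_tuple size_sort size_tuple.
    move=> i; rewrite size_tuple => lin.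
    by rewrite (BE (Ordinal lin)) -(tnth_nth _ _ (Ordinal lin)) tnth_mktuple.
  by apply: sort_sorted; exact: le_total.
Qed.

End CoefsToRoots.

(** * The equivalence *)

Theorem theorem3p1 (R : realType) (n : nat) (Pc : 'I_n.+1 -> R -> R[i])
    (Pc_germ : forall j, is_germ (Pc j))
    (Pc_monic : \forall e \near 0^'+, Pc ord_max e = 1) :
  ((exists (Yf : 'I_n -> R -> R[i]) (y : n.-tuple R[i]) (Y : n.-tuple (\bar R)),
      root_asymp Pc Yf y Y)
   <->
   (exists (p : {poly R[i]}) (P : 'I_n.+1 -> \bar R) (c : n.-tuple (\bar R)),
      coef_asymp Pc p P c))
  /\
  (forall (Yf : 'I_n -> R -> R[i]) (y : n.-tuple R[i]) (Y : n.-tuple (\bar R))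
      (p : {poly R[i]}) (P : 'I_n.+1 -> \bar R) (c : n.-tuple (\bar R)),
    root_asymp Pc Yf y Y -> coef_asymp Pc p P c ->
    let eP := fun j => exponent (Pc j) in
    [/\ forall j, (P j <= eP j)%E,
        forall j, minplus_bar eP j = minplus_bar P j,
        [/\ minplus_roots eP c, minplus_roots P c & c = Y] &
        forall (c0 : R) (i k : nat),
          (0 < k)%N -> count_mem c0%:E c = k ->
          (forall j, (i <= j < i + k)%N -> nth +oo%E c j = c0%:E) ->
          nonzero_root_list (saturated_part p P c0)
            [seq nth 0 y j | j <- iota i k]]).
Proof.
split.
  split=> [[Yf [y [Y YfP]]]|[p [P [c PcP]]]]; last exact: (coefs_to_roots Pc_germ Pc_monic PcP).
  have [p [P PcP]] := roots_to_coefs Pc_monic YfP.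
  by exists p, P, Y.
move=> Yf y Y p P c YfP PcP eP.
have [_ [_ P0] _ Prc _] := PcP; have [sc cN _] := Prc.
have eP0 := exponents_max PcP; have ePc := exponents_roots PcP.
have cY : c = Y.
  have [p' [P' PcP']] := roots_to_coefs Pc_monic YfP.
  have ePY := exponents_roots PcP'; have [sY YN _] := ePY.
  apply: sum_min_uniq => // t; apply: EFin_inj.
  by rewrite -(minplus_rootsE eP0 ePc) -(minplus_rootsE eP0 ePY).
split=> //; [exact: le_exponents PcP|exact: exponents_bar PcP|].
move=> c0 i k k0 ck hc; rewrite cY in ck hc.
have [[_ hP] _ _ _ _] := PcP.
rewrite (saturated_limit_poly Pc_monic YfP hP); last first.
  by rewrite (minplus_rootsE P0 Prc) cY.
exact: (limit_poly_nonzero_roots YfP k0 ck hc).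
Qed.
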